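(* Let $\mathcal{G}=(G;T_1,T_2;\theta)\in\mathcal{G}_2^{sym}$ with $\mathcal{G}\neq\mathcal{K}_1$. Then $\mathcal{G}$ has a $\mathcal{C}_s$-realisation in the plane.
   Context: A multi-graph is finite and loop-free, possibly with parallel edges. A $2$-tree decomposition is $(G;T_1,T_2)$ with $G$ a multi-graph and $T_1,T_2$ spanning trees of $G$ whose edge sets partition $E(G)$. Let $\mathbb{Z}_2=\langle s\rangle$. A $\mathbb{Z}_2$-symmetric multi-graph is $(G,\theta)$ with $\theta:\mathbb{Z}_2\to\mathrm{Aut}(G)$ a non-trivial homomorphism; $s_\theta=\theta(s)$, $s_\theta(v_1v_2)=s_\theta(v_1)s_\theta(v_2)$; an edge $e$ is fixed if $s_\theta(e)=e$. A symmetric $2$-tree decomposition is $(G;T_1,T_2;\theta)$ with $(G;T_1,T_2)$ a $2$-tree decomposition, $(G,\theta)$ $\mathbb{Z}_2$-symmetric and $s_\theta(T_i)=T_i$. $\mathcal{G}_2^{sym}$ is the set of symmetric $2$-tree decompositions with no fixed edges, together with $\mathcal{K}_1$ (a single vertex, edgeless trees, trivial $\theta$). Realisations: a framework $(G,p)$ in $\mathbb{R}^d$ is a multi-graph $G$ with an injective $p:V(G)\to\mathbb{R}^d$; $\|x\|_\infty=\max_i|x\cdot e_i|$. If $u,w$ are joined by exactly $t\ge1$ edges, $\{p(u),p(w)\}$ is well-positioned if there are exactly $t$ distinct indices $k$ with $\|p(u)-p(w)\|_\infty=|(p(u)-p(w))\cdot e_k|$ (its framework colours); $(G,p)$ is well-positioned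 if all adjacent pairs are; a framework colouring $\kappa_p$ assigns to the $t$ edges between $u,w$ these $t$ colours bijectively. A realisation of $(G;T_1,\dots,T_d)$ is a well-positioned $(G,p)$ in $\mathbb{R}^d$ with $\kappa_p^{-1}(i)=E(T_i)$ for all $i$, for some framework colouring. A $\mathcal{C}_s$-realisation of a symmetric $2$-tree decomposition $(G;T_1,T_2;\theta)$ is a pair $(p,\tau)$ where $p:V(G)\to\mathbb{R}^2$ is injective, $\tau:\mathbb{Z}_2\to GL(\mathbb{R}^2)$ is a representation with $\tau(s)$ a reflection in a coordinate axis, $\tau(s)(p(v))=p(s_\theta(v))$ for all $v$, and $(G,p)$ is a realisation of $(G;T_1,T_2)$. *)

(* Defs.v *)
From HB Require Import structures.
From mathcomp Require Import all_boot.
From Stdlib Require Import Reals.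

Set Implicit Arguments.
Unset Strict Implicit.
Unset Printing Implicit Defensive.

Definition Rleb (x y : R) : bool := if Rle_dec x y then true else false.

Section MultiGraph.
Variables (V E : finType) (src tgt : E -> V).

Definition loopfree : Prop := forall e, src e != tgt e.

Definition joins (e : E) (u w : V) : bool :=
  ((src e == u) && (tgt e == w)) || ((src e == w) && (tgt e == u)).

Definition edges_between (u w : V) : {set E} := [set e | joins e u w].

Definition adj_in (F : {set E}) : rel V :=
  fun u w => [exists e in F, joins e u w].

Definition connected_in (F : {set E}) : Prop :=
  forall u w : V, connect (adj_in F) u w.

Definition is_cycle_in (F : {set E}) (es : seq E) (vs : seq V) : bool :=
  [&& 0 < size es, size vs == size es, uniq es, uniq vs,
      all (fun e => e \in F) es &
      all (fun x => joins x.1 x.2.1 x.2.2) (zip es (zip vs (rot 1 vs)))].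

Definition acyclic_in (F : {set E}) : Prop :=
  forall es vs, ~~ is_cycle_in F es vs.

Definition spanning_tree (F : {set E}) : Prop :=
  connected_in F /\ acyclic_in F.

Definition tree_decomposition (d : nat) (T : 'I_d -> {set E}) : Prop :=
  loopfree /\
  (forall i, spanning_tree (T i)) /\
  (forall e, exists i, e \in T i) /\
  (forall i j e, e \in T i -> e \in T j -> i = j).

Definition is_aut (sV : V -> V) (sE : E -> E) : Prop :=
  bijective sV /\ bijective sE /\
  forall e, joins (sE e) (sV (src e)) (sV (tgt e)).

(* a non-trivial homomorphism Z_2 -> Aut(G), given by s_theta = (sV, sE) *)
Definition Z2_symmetric (sV : V -> V) (sE : E -> E) : Prop :=
  is_aut sV sE /\ (forall v, sV (sV v) = v) /\ (forall e, sE (sE e) = e) /\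
  ~ ((forall v, sV v = v) /\ (forall e, sE e = e)).

Definition sym_2tree_decomposition (T : 'I_2 -> {set E})
  (sV : V -> V) (sE : E -> E) : Prop :=
  tree_decomposition T /\ Z2_symmetric sV sE /\
  (forall i, sE @: T i = T i).

Definition no_fixed_edges (sE : E -> E) : Prop := forall e, sE e != e.

Definition point (d : nat) := {ffun 'I_d -> R}.

(* framework colours of the pair {x,y}: indices k where
   |(x - y).e_k| equals ||x - y||_inf = max_j |(x - y).e_j| *)
Definition fcols (d : nat) (x y : point d) : {set 'I_d} :=
  [set k : 'I_d | [forall j : 'I_d,
      Rleb (Rabs (x j - y j)%R) (Rabs (x k - y k)%R)]].

Definition well_positioned (d : nat) (p : V -> point d) : Prop :=
  forall u w, u != w -> 0 < #|edges_between u w| ->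
    #|fcols (p u) (p w)| = #|edges_between u w|.

Definition framework_colouring (d : nat) (p : V -> point d)
  (kappa : E -> 'I_d) : Prop :=
  forall u w, u != w -> 0 < #|edges_between u w| ->
    {in edges_between u w &, injective kappa} /\
    kappa @: edges_between u w = fcols (p u) (p w).

Definition realisation (d : nat) (T : 'I_d -> {set E}) (p : V -> point d)
  : Prop :=
  injective p /\ well_positioned p /\
  exists kappa : E -> 'I_d, framework_colouring p kappa /\
    (forall e i, (kappa e == i) = (e \in T i)).

Definition coord_reflection (k : 'I_2) (x : point 2) : point 2 :=
  [ffun j => if j == k then (- x j)%R else x j].

(* C_s-realisation (p, tau) with tau(s) = coord_reflection k *)
Definition Cs_realisation (T : 'I_2 -> {set E}) (sV : V -> V)
  (p : V -> point 2) : Prop :=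
  exists k : 'I_2,
    (forall v, p (sV v) = coord_reflection k (p v)) /\
    realisation T p.

End MultiGraph.

(* Main.v *)
Require Import Defs.
From HB Require Import structures.
From mathcomp Require Import all_boot.
From Stdlib Require Import Reals.
From Stdlib Require Import Lra.
From mathcomp Require Import zify.

Set Implicit Arguments.
Unset Strict Implicit.
Unset Printing Implicit Defensive.

(* In the diagonal coordinates x + y and x - y, a C_s-symmetric placement
   has the form v |-> (f v, f (s v)) for a single function f on the
   vertices. An edge uw gets the first colour if f u - f w and f (s u) - f
   (s w) have the same sign, the second if they have opposite signs, and
   both if exactly one of these differences is 0; so f has to identify the
   ends of exactly one of the double edges uw and s(u)s(w). For the
   induction to work one needs more: this choice can be prescribed
   arbitrarily, the fibres of f are then the components of the chosen
   double edges, the two trees may be arbitrary forests, and the colours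
   may be exchanged (the boolean e). Counting degrees yields a vertex v,
   not fixed by s, of total degree at most 3. Delete v and s(v); when v
   has two neighbours a, b in one forest, join a to b and s(a) to s(b) in
   that forest. If this creates a double edge ab, its ends are separated
   again by raising f slightly on one side of it; here one uses the
   freedom in choosing between ab and s(a)s(b) to ensure that the third
   neighbour of v does not lie on the line through a and b. *)

(** * Forests *)

Section Forests.
Variable V : finType.
Implicit Types (t R : rel V) (W X : {set V}) (u v w a b : V).

(** For a loopless symmetric [t] this is acyclicity on [W], since all vertices of a cycle have two
    neighbours in it. In this form it passes to subsets and serves both induction and counting. *)
Definition forest t W : Prop :=
  forall X, X \subset W -> X != set0 ->
    exists2 x, x \in X & #|[set y in X | t x y]| <= 1.

Lemma forestS t W X : X \subset W -> forest t W -> forest t X.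
Proof. by move=> sXW fW Y sYX; apply: fW; apply: subset_trans sXW. Qed.

Lemma forest_two_nbrs t W X : forest t W -> X \subset W -> X != set0 ->
  ~ (forall x, x \in X -> exists y z, [/\ y \in X, z \in X, y != z, t x y & t x z]).
Proof.
move=> fW sXW X0 two; have [x xX] := fW _ sXW X0.
have [y [z [yX zX nyz txy txz]]] := two x xX.
rewrite leqNgt => /negP; apply; apply/card_gt1P; exists y, z.
by rewrite !inE yX zX txy txz.
Qed.

(** Removing a vertex of degree at most 1 lowers the degree sum by at most 2. *)
Lemma forest_sum_degrees t W : symmetric t -> irreflexive t -> forest t W ->
  W != set0 -> \sum_(x in W) #|[set y in W | t x y]| + 2 <= 2 * #|W|.
Proof.
move=> symt irrt; move: {2}#|W| (erefl #|W|) => n.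
elim: n W => [|n IHn] W; first by move/eqP; rewrite cards_eq0 => /eqP-> _; rewrite eqxx.
move=> cW fW W0; have [x xW dx] := fW _ (subxx _) W0.
have cW' : #|W :\ x| = n by have := cardsD1 x W; rewrite xW cW; lia.
rewrite (big_setD1 x xW) /=.
have split_deg y : y \in W :\ x ->
    #|[set z in W | t y z]| = #|[set z in W :\ x | t y z]| + t y x.
  rewrite !inE => /andP[_ yW]; rewrite (cardsD1 x) !inE xW /= addnC.
  by congr (_ + _); apply: eq_card => z; rewrite !inE andbA.
rewrite (eq_bigr _ split_deg) big_split /=.
have -> : \sum_(y in W :\ x) t y x = #|[set y in W | t x y]|.
  rewrite -sum1_card [RHS](eq_bigl (fun y => (y \in W) && t x y)); last by move=> y; rewrite inE.
  rewrite big_mkcondr (big_setD1 x xW) /= irrt add0n; apply: eq_bigr => y _.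
  by rewrite symt; case: (t x y).
have [E|N0] := eqVneq (W :\ x) set0.
  rewrite E !big_set0; have -> : #|[set y in W | t x y]| = 0; last by lia.
  apply: eq_card0 => y; rewrite !inE; apply/andP => -[yW txy].
  have: y \in W :\ x by rewrite !inE yW andbT; apply: contraTneq txy => ->; rewrite irrt.
  by rewrite E inE.
have := IHn _ cW' (forestS (subD1set _ _) fW) N0; lia.
Qed.

Lemma path_inner_nbrs R u p x : symmetric R -> path R u p -> uniq (u :: p) ->
  x \in p -> x != last u p ->
  exists y z, [/\ y \in u :: p, z \in u :: p, y != z, R x y & R x z].
Proof.
move=> symR + + xp; case/splitPr: p / xp => p1 p2.
rewrite cat_path last_cat /= => /and3P[_ Rx Rp2].
case: p2 Rp2 => [|z p2] /=; first by rewrite eqxx.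
move=> /andP[Rxz _] uq _; exists (last u p1), z; split => //.
- by rewrite -cat_cons mem_cat mem_last.
- by rewrite inE mem_cat !inE eqxx !orbT.
- apply/eqP => E; move: uq; rewrite -[_ && _]/(uniq ((u :: p1) ++ x :: z :: p2)).
  rewrite cat_uniq => /and3P[_ /hasPn/(_ z)]; rewrite -E mem_last.
  by rewrite !inE eqxx orbT => /(_ isT).
- by rewrite symR.
Qed.

(** In the union of the two paths every vertex has two neighbours: an inner vertex along its path,
    [u] and [w] by the hypotheses on the first and last steps. The paths may cross; no cycle has to
    be extracted. *)
Lemma forest_two_paths t W u w q1 q2 : symmetric t -> forest t W ->
  {subset u :: rcons q1 w <= W} -> {subset u :: rcons q2 w <= W} ->
  path t u (rcons q1 w) -> path t u (rcons q2 w) ->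
  uniq (u :: rcons q1 w) -> uniq (u :: rcons q2 w) ->
  head w q1 != head w q2 -> last u q1 != last u q2 -> False.
Proof.
move=> symt fW s1 s2 p1 p2 uq1 uq2 hne lne.
have first q : path t u (rcons q w) -> t u (head w q) /\ head w q \in rcons q w.
  by case: q => [|y q] /= /andP[-> _]; rewrite !inE eqxx.
have lastn q : path t u (rcons q w) -> t w (last u q) /\ last u q \in u :: rcons q w.
  rewrite rcons_path => /andP[_]; rewrite symt => ->; split=> //.
  by rewrite -rcons_cons mem_rcons inE mem_last orbT.
pose X := [set x in (u :: rcons q1 w) ++ (u :: rcons q2 w)].
apply: (@forest_two_nbrs t W X fW).
- by apply/subsetP => x; rewrite in_set mem_cat => /orP[/s1|/s2].
- by apply/set0Pn; exists u; rewrite in_set mem_cat mem_head.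
have inX1 x : x \in u :: rcons q1 w -> x \in X by rewrite in_set mem_cat => ->.
have inX2 x : x \in u :: rcons q2 w -> x \in X by rewrite in_set mem_cat orbC => ->.
move=> x xX; have [->{x xX}|nxu] := eqVneq x u.
  have [? ?] := first _ p1; have [? ?] := first _ p2.
  exists (head w q1), (head w q2); split=> //.
    by apply: inX1; rewrite inE orbC; apply/orP; left.
  by apply: inX2; rewrite inE orbC; apply/orP; left.
have [->{x xX nxu}|nxw] := eqVneq x w.
  have [? ?] := lastn _ p1; have [? ?] := lastn _ p2.
  by exists (last u q1), (last u q2); split=> //; [apply: inX1|apply: inX2].
move: xX; rewrite in_set mem_cat !inE (negbTE nxu) /= => /orP[] xq.
  have [|y [z [yq zq ? ? ?]]] := path_inner_nbrs symt p1 uq1 xq _; first by rewrite last_rcons.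
  by exists y, z; split=> //; apply: inX1.
have [|y [z [yq zq ? ? ?]]] := path_inner_nbrs symt p2 uq2 xq _; first by rewrite last_rcons.
by exists y, z; split=> //; apply: inX2.
Qed.

(** Simple paths in edge-disjoint subgraphs differ in their first and last edges, so
    [forest_two_paths] applies. *)
Lemma forest_connect_disjoint t R1 R2 W u w :
  symmetric t -> forest t W ->
  (forall x y, R1 x y -> [&& x \in W, y \in W & t x y]) ->
  (forall x y, R2 x y -> [&& x \in W, y \in W & t x y]) ->
  (forall x y, R1 x y -> R1 y x) -> (forall x y, R2 x y -> R2 y x) ->
  (forall x y, R1 x y -> ~~ R2 x y) ->
  connect R1 u w -> connect R2 u w -> u = w.
Proof.
move=> symt fW sub1 sub2 sym1 sym2 dis c1 c2; apply/eqP/negPn/negP => nuw.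
have decomp R : (forall x y, R x y -> [&& x \in W, y \in W & t x y]) ->
  connect R u w -> exists q,
   [/\ {subset u :: rcons q w <= W}, path t u (rcons q w), uniq (u :: rcons q w),
       R u (head w q) & R (last u q) w].
  move=> sub /connectP[p0 p0P w_def]; case/shortenP: p0P w_def => p pP uq _ w_def.
  case/lastP: p pP uq w_def => [|q w'] pP uq; first by move=> /= E; rewrite E eqxx in nuw.
  rewrite last_rcons => E; subst w'; exists q; split=> //.
  - move=> x; rewrite inE => /orP[/eqP->|].
      by case: q pP {uq} => [|y q] /= /andP[/sub/and3P[]].
    elim: (rcons q w) u pP {uq nuw c1 c2} => //= y p IHp v /andP[/sub/and3P[_ yW _]].
    by move=> /IHp{}IHp; rewrite inE => /orP[/eqP->|/IHp].
  - by apply: sub_path pP => x y /sub/and3P[].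
  - by case: q pP {uq} => [|y q] /= /andP[].
  - by move: pP; rewrite rcons_path => /andP[].
have [q1 [s1 p1 u1 h1 l1]] := decomp _ sub1 c1.
have [q2 [s2 p2 u2 h2 l2]] := decomp _ sub2 c2.
apply: (forest_two_paths symt fW s1 s2 p1 p2 u1 u2).
  by apply: contraTneq h2 => <-; apply: dis.
by apply: contraTneq l2 => <-; apply: dis.
Qed.

Definition pair_rel a b : rel V :=
  fun u w => (u == a) && (w == b) || (u == b) && (w == a).

Definition add_edge t a b : rel V := fun u w => t u w || pair_rel a b u w.

Lemma pair_relC a b u w : pair_rel a b u w = pair_rel a b w u.
Proof. by rewrite /pair_rel orbC; congr (_ || _); rewrite andbC. Qed.

Lemma pair_relP a b u w : reflect (u = a /\ w = b \/ u = b /\ w = a) (pair_rel a b u w).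
Proof.
apply: (iffP orP) => -[] => [/andP[/eqP-> /eqP->]|/andP[/eqP-> /eqP->]|[-> ->]|[-> ->]].
- by left.
- by right.
- by left; rewrite !eqxx.
- by right; rewrite !eqxx.
Qed.

(** The single edge [uw] serves as the second of two edge-disjoint subgraphs. *)
Lemma forest_edge_bridge t R W u w : symmetric t -> irreflexive t -> forest t W ->
  symmetric R -> (forall x y, R x y -> [&& x \in W, y \in W & t x y]) ->
  u \in W -> w \in W -> t u w -> ~~ R u w -> ~~ connect R u w.
Proof.
move=> symt irrt fW symR sub uW wW tuw nR; apply/negP => c.
suff E : u = w by rewrite E irrt in tuw.
apply: (forest_connect_disjoint (R2 := pair_rel u w) symt fW sub _ _ _ _ c) => //.
- by move=> x y /pair_relP[] [-> ->]; rewrite uW wW //= symt.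
- by move=> x y; rewrite symR.
- by move=> x y; rewrite pair_relC.
- move=> x y Rxy; apply/negP => /pair_relP[] [Ex Ey]; move: nR; subst.
    by rewrite Rxy.
  by rewrite symR Rxy.
- by apply: connect1; apply/pair_relP; left.
Qed.

(* Suppressing [v]: a set containing [a] and [b] is tested together with [v]. *)
Lemma forest_suppress t W v a b : forest t W -> symmetric t -> v \in W ->
  a != b -> t v a -> t v b -> forest (add_edge t a b) (W :\ v).
Proof.
move=> fW symt vW nab tva tvb X sX X0.
have sXW : X \subset W by apply: subset_trans sX (subD1set _ _).
have nvX : v \notin X by apply/negP => /(subsetP sX); rewrite !inE eqxx.
have [/andP[aX bX]|nX] := boolP ((a \in X) && (b \in X)); last first.
  have [x xX dx] := fW _ sXW X0; exists x => //.
  rewrite (@eq_card _ _ [set y in X | t x y]) // => y; rewrite !inE.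
  have [yX|//] /= := boolP (y \in X); rewrite /add_edge.
  case E: (pair_rel a b x y); rewrite ?orbF //.
  by move: nX; case/pair_relP: E xX yX => -[-> ->] -> ->.
have sv : v |: X \subset W by rewrite subUset sub1set vW.
have v0 : v |: X != set0 by apply/set0Pn; exists v; rewrite !inE eqxx.
have [x xvX dx] := fW _ sv v0.
have nxv : x != v.
  apply: contraTneq dx => ->; rewrite -ltnNge; apply/card_gt1P; exists a, b.
  by rewrite !inE aX bX tva tvb !orbT.
have xX : x \in X by move: xvX; rewrite !inE (negbTE nxv).
exists x => //; have [xab|/norP[nxa nxb]] := boolP ((x == a) || (x == b)); last first.
  apply: leq_trans dx; apply: subset_leq_card; apply/subsetP => y; rewrite !inE.
  rewrite /add_edge /pair_rel (negbTE nxa) (negbTE nxb) orbF.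
  by move=> /andP[-> ->]; rewrite orbT.
have txv : t x v by rewrite symt; case/orP: xab => /eqP->.
(* Now [v] is the only neighbour that [x] may have in [v |: X], so the new edge is the only one at
   [x] inside [X]. *)
have nbr y : y \in X -> ~~ t x y.
  move=> yX; apply/negP => txy; move: dx; rewrite leqNgt => /negP; apply.
  apply/card_gt1P; exists v, y; rewrite !inE eqxx yX txv txy orbT; split=> //.
  by apply: contraNneq nvX => ->.
apply: (@leq_trans #|[set (if x == a then b else a)]|); last by rewrite cards1.
apply: subset_leq_card; apply/subsetP => y; rewrite !inE => /andP[yX].
rewrite /add_edge (negbTE (nbr y yX)) /= => /pair_relP[] [-> ->]; first by rewrite eqxx.
by rewrite [b == a]eq_sym (negbTE nab).
Qed.

Lemma connect_isolated R v u : (forall w, ~~ R v w) -> connect R v u = (v == u).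
Proof.
move=> iso; apply/idP/eqP => [/connectP[[|y p] /=]|->]; last exact: connect0.
  by move=> _ ->.
by rewrite (negbTE (iso y)).
Qed.

Lemma connect_pendant R v z : symmetric R -> v != z ->
  (forall w, R v w = (w == z)) -> forall u w,
  connect R u w = connect (fun x y => [&& R x y, x != v & y != v])
    (if u == v then z else u) (if w == v then z else w).
Proof.
move=> symR nvz pend u w; set R0 := (fun x y => _); set pi := fun x => if x == v then z else x.
rewrite -[X in connect R0 X _]/(pi u) -[X in connect R0 _ X]/(pi w).
have sym0 : connect_sym R0.
  by apply: sym_connect_sym => x y; rewrite /R0 symR; case: (R y x) => //=; rewrite andbC.
have symc : connect_sym R by apply: sym_connect_sym.
have cpi x : connect R x (pi x).
  by rewrite /pi; case: eqP => [->|_]; [rewrite connect1 // pend | exact: connect0].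
apply/idP/idP.
  case/connectP => p + ->; elim: p u => [|y p IHp] u /=; first by move=> _; exact: connect0.
  move=> /andP[Ruy /IHp]; apply: connect_trans; rewrite /pi.
  have [Eu|nu] := eqVneq u v; have [Ey|ny] := eqVneq y v.
  - exact: connect0.
  - by move: Ruy; rewrite Eu pend => /eqP->; apply: connect0.
  - by move: Ruy; rewrite Ey symR pend => /eqP->; apply: connect0.
  - by apply: connect1; rewrite /R0 Ruy nu ny.
move=> c0; apply: connect_trans (cpi u) _; rewrite symc; apply: connect_trans (cpi w) _.
rewrite symc; apply: connect_sub c0 => x y /and3P[Rxy _ _]; exact: connect1.
Qed.

Lemma connect_add_edge R a b u w : symmetric R ->
  connect (add_edge R a b) u w =
  [|| connect R u w, connect R u a && connect R b w | connect R u b && connect R a w].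
Proof.
move=> symR; have symc : connect_sym R by apply: sym_connect_sym.
have syma : connect_sym (add_edge R a b).
  by apply: sym_connect_sym => x y; rewrite /add_edge symR pair_relC.
have subc x y : connect R x y -> connect (add_edge R a b) x y.
  by apply: connect_sub => {}x {}y Rxy; apply: connect1; rewrite /add_edge Rxy.
have cab : connect (add_edge R a b) a b.
  by apply: connect1; rewrite /add_edge /pair_rel !eqxx orbT.
apply/idP/idP; last first.
  case/or3P => [/subc//|/andP[/subc c1 /subc c2]|/andP[/subc c1 /subc c2]].
    exact: connect_trans c1 (connect_trans cab c2).
  by apply: connect_trans c1 (connect_trans _ c2); rewrite syma.
case/connectP => p + ->; elim: p u => [|y p IHp] u /=; first by rewrite connect0.
case/andP; rewrite {1}/add_edge => /orP[Ruy|/pair_relP[] [-> ->]] /IHp; move: (last y p) => z.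
- have cuy := connect1 Ruy.
  by rewrite !(same_connect symc cuy).
- by rewrite !connect0 /=; case/or3P => [->|/andP[_ ->]|->]; rewrite ?orbT.
- by rewrite !connect0 /=; case/or3P => [->|->|/andP[_ ->]]; rewrite ?orbT.
Qed.

End Forests.

(** * Placing symmetric pairs of forests *)

Section SymmetricForests.
Variables (V : finType) (s : V -> V).
Hypothesis sK : involutive s.
Implicit Types (t D : rel V) (W X : {set V}) (u v w a b c : V).
Implicit Types (f g : V -> nat) (e : bool).

Let s_inj : injective s := inv_inj sK.

Lemma connect_conj D u w :
  connect D (s u) (s w) = connect (fun x y => D (s x) (s y)) u w.
Proof.
apply/idP/idP => [c|].
  rewrite -[u]sK -[w]sK; case/connectP: c => p + ->; elim: p (s u) => [|y p IHp] x /=.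
    by move=> _; exact: connect0.
  case/andP=> Dxy /IHp{}IHp; apply: connect_trans IHp.
  by apply: connect1; rewrite !sK.
case/connectP => p + ->; elim: p u => [|y p IHp] x /=; first by move=> _; exact: connect0.
by case/andP=> Dxy /IHp{}IHp; apply: connect_trans IHp; apply: connect1.
Qed.

(** [sg_fix] excludes edges from a vertex to its image, since [s] would map such an edge to
    itself. *)
Record sym_graph t : Prop := SymGraph {
  sg_sym : symmetric t;
  sg_irr : irreflexive t;
  sg_inv : forall u w, t (s u) (s w) = t u w;
  sg_fix : forall u, ~~ t u (s u) }.

(* [D] contains exactly one of the double edges [uw] and [s u, s w]: it
   consists of the double edges whose ends get the same [f]-value. *)
Record selection W t1 t2 D : Prop := Selection {
  sel_sym : symmetric D;
  sel_sub : forall u w, D u w -> [/\ u \in W, w \in W, t1 u w & t2 u w];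
  sel_xor : {in W &, forall u w, t1 u w -> t2 u w -> D u w (+) D (s u) (s w)} }.

(** The invariant of the induction. [fr_fix] allows at most one fixed vertex; it is carried along
    because forests alone do not imply it. *)
Record frame W t1 t2 D : Prop := Frame {
  fr_s : forall u, (s u \in W) = (u \in W);
  fr_fix : {in W &, forall u w, s u = u -> s w = w -> u = w};
  fr_g1 : sym_graph t1;
  fr_g2 : sym_graph t2;
  fr_f1 : forest t1 W;
  fr_f2 : forest t2 W;
  fr_sel : selection W t1 t2 D }.

Definition fibres W D f : Prop :=
  {in W &, forall u w, (f u == f w) = connect D u w}.

(** Only edges of exactly one forest are constrained; double edges are settled by [fibres]. With [e]
    false, [f] and its conjugate grow in the same direction along an edge of [t1]. *)
Definition edge_ok t1 t2 e f u w : Prop :=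
  t1 u w (+) t2 u w -> (f u < f w) (+) (f (s u) < f (s w)) = t2 u w (+) e.

Definition good W t1 t2 D e f : Prop :=
  fibres W D f /\ {in W &, forall u w, edge_ok t1 t2 e f u w}.

Lemma frame_swap W t1 t2 D : frame W t1 t2 D -> frame W t2 t1 D.
Proof.
case=> ss sf g1 g2 f1 f2 [sy sb sx]; split=> //; split=> //.
  by move=> u w /sb[].
by move=> u w uW wW h1 h2; apply: sx.
Qed.

(** Lets the induction assume that the removed vertex has at least as many neighbours in [t1] as in
    [t2]. *)
Lemma good_swap W t1 t2 D e f : good W t1 t2 D e f -> good W t2 t1 D (~~ e) f.
Proof.
move=> [fib ed]; split=> // u w uW wW; rewrite /edge_ok addbC => h.
rewrite (ed _ _ uW wW h) addbN -addNb.
by case: (t1 u w) (t2 u w) h => -[].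
Qed.

(** * Degree counting, deletion of an orbit and its reinsertion *)

Section Frame.
Variables (W : {set V}) (t1 t2 D : rel V) (e : bool).
Hypothesis fr : frame W t1 t2 D.

Let symD := sel_sym (fr_sel fr).
Let subD := sel_sub (fr_sel fr).
Let g1 := fr_g1 fr.
Let g2 := fr_g2 fr.

(** A simple edge is a bridge of its forest and does not belong to [D], so [D] cannot connect its
    ends. Comparisons along simple edges are therefore strict. *)
Lemma frame_xor_neq f : fibres W D f -> {in W &, forall u w,
  t1 u w (+) t2 u w -> f u != f w /\ f (s u) != f (s w)}.
Proof.
move=> fib.
have neq : {in W &, forall u w, t1 u w (+) t2 u w -> f u != f w}.
  move=> u w uW wW x; rewrite (fib _ _ uW wW).
  have nD : ~~ D u w by apply: contraL x => /subD[_ _ -> ->].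
  case h1: (t1 u w) x => /= x.
    apply: (forest_edge_bridge (sg_sym g1) (sg_irr g1) (fr_f1 fr)) => // y z.
    by case/subD => -> -> -> _.
  apply: (forest_edge_bridge (sg_sym g2) (sg_irr g2) (fr_f2 fr)) => // y z.
  by case/subD => -> -> _ ->.
move=> u w uW wW x; split; first exact: neq.
by apply: neq; rewrite ?(fr_s fr) // !(sg_inv g1, sg_inv g2).
Qed.

(** By [sel_xor], [D] and its conjugate are edge-disjoint in the forest [t1], so vertices connected
    in both coincide. This makes the placement injective. *)
Lemma fibres_inj f : fibres W D f ->
  {in W &, forall u w, f u = f w -> f (s u) = f (s w) -> u = w}.
Proof.
move=> fib u w uW wW /eqP; rewrite fib // => c1 /eqP.
rewrite fib ?(fr_s fr) // => c2.
apply: (forest_connect_disjoint (R1 := D) (R2 := fun x y => D (s x) (s y))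
  (sg_sym g1) (fr_f1 fr)) => //.
- by move=> x y /subD[-> ->].
- by move=> x y /subD[]; rewrite !(fr_s fr) (sg_inv g1) => -> ->.
- by move=> x y; rewrite symD.
- by move=> x y; rewrite symD.
- move=> x y Dxy; have [xW yW h1 h2] := subD Dxy.
  by have := sel_xor (fr_sel fr) xW yW h1 h2; rewrite Dxy.
by rewrite -connect_conj.
Qed.

(** Both comparisons are strict, so both flip and the exclusive or is unchanged. *)
Lemma edge_ok_sym f u w : fibres W D f -> u \in W -> w \in W ->
  edge_ok t1 t2 e f u w -> edge_ok t1 t2 e f w u.
Proof.
move=> fib uW wW; rewrite /edge_ok (sg_sym g1) (sg_sym g2) => ok h.
by have := ok h; have [] := frame_xor_neq fib wW uW h; lia.
Qed.

Definition degree t v := #|[set y in W | t v y]|.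

(** The degree sums of the two forests add up to at most [4 * #|W| - 4], so some vertex has total
    degree at most 3; the possible fixed vertex needs extra care. *)
Lemma frame_low_degree x : x \in W -> s x != x ->
  exists v, [/\ v \in W, s v != v & degree t1 v + degree t2 v <= 3].
Proof.
move=> xW sx.
have [/exists_inP[v vW /andP[]]|] :=
  boolP [exists v in W, (s v != v) && (degree t1 v + degree t2 v <= 3)].
  by exists v.
rewrite negb_exists_in => /forall_inP big; exfalso.
have {}big v : v \in W -> s v != v -> 4 <= degree t1 v + degree t2 v.
  by move=> vW sv; have := big _ vW; rewrite sv /= -ltnNge.
have sum_big X : X \subset W -> {in X, forall v, s v != v} ->
    4 * #|X| <= \sum_(v in X) (degree t1 v + degree t2 v).
  move=> sXW sX; rewrite mulnC -sum_nat_const; apply: leq_sum => v vX.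
  by apply: big; [exact: (subsetP sXW) | exact: sX].
have sum_small X : X \subset W -> X != set0 ->
    \sum_(v in X) (#|[set y in X | t1 v y]| + #|[set y in X | t2 v y]|) + 4 <= 4 * #|X|.
  move=> sXW X0; rewrite big_split /=.
  have := forest_sum_degrees (sg_sym g1) (sg_irr g1) (forestS sXW (fr_f1 fr)) X0.
  have := forest_sum_degrees (sg_sym g2) (sg_irr g2) (forestS sXW (fr_f2 fr)) X0.
  by lia.
have W0 : W != set0 by apply/set0Pn; exists x.
have [/exists_inP[z zW /eqP sz]|] := boolP [exists z in W, s z == z]; last first.
  rewrite negb_exists_in => /forall_inP nofix.
  by have := sum_big W (subxx _) nofix; have := sum_small W (subxx _) W0; rewrite /degree; lia.
have sXW : W :\ z \subset W by exact: subD1set.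
have nofix : {in W :\ z, forall v, s v != v}.
  move=> v; rewrite !inE => /andP[nvz vW]; apply: contra nvz => /eqP sv.
  by apply/eqP; apply: (fr_fix fr).
have cW : #|W| = #|W :\ z|.+1 by rewrite (cardsD1 z) zW.
have := sum_big _ sXW nofix; have := sum_small W (subxx _) W0.
rewrite (big_setD1 z zW) /= /degree cW => le1 le2.
(* If all other vertices have degree at least 4, they exhaust the bound and [z] is isolated; the
   bound for [W :\ z] is then violated. *)
have [d1 d2] : degree t1 z = 0 /\ degree t2 z = 0 by rewrite /degree; lia.
have eqdeg t v : symmetric t -> degree t z = 0 -> v \in W ->
    degree t v = #|[set y in W :\ z | t v y]|.
  move=> symt /eqP; rewrite cards_eq0 => /eqP d0 vW; apply: eq_card => y; rewrite !inE.
  have [->|//] := eqVneq y z; rewrite zW /=; apply: negbTE; rewrite symt.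
  by apply/negP => tzv; have := in_set0 v; rewrite -d0 inE vW tzv.
have X0 : W :\ z != set0.
  apply/set0Pn; exists x; rewrite !inE xW andbT; apply: contraNneq sx => ->.
  by rewrite sz.
have := sum_small _ sXW X0; have := sum_big _ sXW nofix.
rewrite (eq_bigr (fun v => #|[set y in W :\ z | t1 v y]| + #|[set y in W :\ z | t2 v y]|)).
  by lia.
move=> v /(subsetP sXW) vW; congr (_ + _).
  exact: (eqdeg _ _ (sg_sym g1) d1 vW).
exact: (eqdeg _ _ (sg_sym g2) d2 vW).
Qed.

Definition delete v := W :\ v :\ s v.
Definition induced X D : rel V := fun u w => [&& u \in X, w \in X & D u w].

Lemma in_delete v u : (u \in delete v) = [&& u != v, u != s v & u \in W].
Proof. by rewrite !inE andbCA. Qed.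

Lemma delete_sub v : delete v \subset W.
Proof. by apply/subsetP => u; rewrite in_delete => /and3P[]. Qed.

Lemma delete_conj v : delete (s v) = delete v.
Proof. by apply/setP => u; rewrite !in_delete sK andbCA. Qed.

Lemma delete_s v u : (s u \in delete v) = (u \in delete v).
Proof.
rewrite !in_delete (fr_s fr) (inj_eq s_inj) andbCA.
by rewrite -[s u == v](inj_eq s_inj) sK.
Qed.

Lemma delete_cases v u : u \in W -> [\/ u = v, u = s v | u \in delete v].
Proof.
rewrite in_delete => ->; have [->|] := eqVneq u v; first by constructor 1.
by have [->|] := eqVneq u (s v); [constructor 2 | constructor 3].
Qed.

Lemma frame_delete v : frame (delete v) t1 t2 (induced (delete v) D).
Proof.
have sub u : u \in delete v -> u \in W by apply: (subsetP (delete_sub v)).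
split=> //.
- by move=> u; rewrite delete_s.
- by move=> u w /sub uW /sub wW; apply: (fr_fix fr).
- exact: forestS (delete_sub v) (fr_f1 fr).
- exact: forestS (delete_sub v) (fr_f2 fr).
split.
- by move=> u w; rewrite /induced symD andbCA.
- by move=> u w /and3P[-> -> /subD[]].
move=> u w uX wX h1 h2; rewrite /induced !delete_s uX wX /=.
by apply: (sel_xor (fr_sel fr)) => //; apply: sub.
Qed.

Lemma card_delete v : v \in W -> #|delete v| < #|W|.
Proof.
move=> vW; apply: proper_card; apply/properP; split; first exact: delete_sub.
by exists v; rewrite // in_delete eqxx.
Qed.

(** Conjugation exchanges the two comparisons, so the edges at [s v] follow from those at [v]; the
    vertices [v] and [s v] are not adjacent. *)
Lemma good_of_delete v g : v \in W -> fibres W D g ->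
  {in delete v, forall u, edge_ok t1 t2 e g v u} ->
  {in delete v &, forall u w, edge_ok t1 t2 e g u w} -> good W t1 t2 D e g.
Proof.
move=> vW fib okv okd; split=> // u w uW wW.
have sub x : x \in delete v -> x \in W by apply: (subsetP (delete_sub v)).
have svW : s v \in W by rewrite (fr_s fr).
have irr x : edge_ok t1 t2 e g x x by rewrite /edge_ok (sg_irr g1) (sg_irr g2).
have nadj x : edge_ok t1 t2 e g x (s x).
  by rewrite /edge_ok (negbTE (sg_fix g1 x)) (negbTE (sg_fix g2 x)).
have okv' x : x \in delete v -> edge_ok t1 t2 e g (s v) x.
  move=> xX; have := okv (s x); rewrite delete_s => /(_ xX).
  by rewrite /edge_ok -(sg_inv g1) -(sg_inv g2) !sK [_ (+) (g v < _)]addbC.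
case: (delete_cases v uW) => [->|->|uX]; case: (delete_cases v wW) => [->|->|wX] //.
- exact: okv.
- by rewrite -{2}[v]sK; apply: nadj.
- exact: okv'.
- by apply: edge_ok_sym => //; apply: okv.
- by apply: edge_ok_sym => //; apply: okv'.
- exact: okd.
Qed.

(** The point of [v] is given by two thresholds, [k] among the values of [f] and [k'] among those of
    the conjugate. The last hypothesis puts each simple neighbour in a quadrant of the right colour
    around this point. *)
Lemma extend_free v f k k' : v \in W -> s v != v ->
  (forall u, ~~ D v u) -> (forall u, ~~ D (s v) u) ->
  good (delete v) t1 t2 (induced (delete v) D) e f ->
  {in delete v, forall u, t1 v u (+) t2 v u ->
     (k <= f u) (+) (k' <= f (s u)) = t2 v u (+) e} ->
  exists g, good W t1 t2 D e g.
Proof.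
move=> vW nsv isov isosv [fib ed] cut.
(* The factor 3 makes room between old values, and the residues 1, 2, 0 keep [v], [s v] and the old
   vertices apart. Being smaller than [3 * f u + 3] amounts to [k <= f u] for [v] and to [k' <= f u]
   for [s v]. *)
pose g u := if u == v then 3 * k + 1 else if u == s v then 3 * k' + 2 else 3 * f u + 3.
have gv : g v = 3 * k + 1 by rewrite /g eqxx.
have gsv : g (s v) = 3 * k' + 2 by rewrite /g (negbTE nsv) eqxx.
have gd u : u \in delete v -> g u = 3 * f u + 3.
  by rewrite in_delete => /and3P[/negbTE n1 /negbTE n2 _]; rewrite /g n1 n2.
have symc : connect_sym D by apply: sym_connect_sym.
have eqD : D =2 induced (delete v) D.
  move=> u w; rewrite /induced !in_delete.
  case Duw: (D u w); rewrite ?andbF ?andbT //; have [-> -> _ _] := subD Duw.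
  have h x : D x u || D x w -> (x != v) && (x != s v).
    apply: contraTT; rewrite negb_and !negbK => /orP[] /eqP->.
      by rewrite !(negbTE (isov _)).
    by rewrite !(negbTE (isosv _)).
  by rewrite !andbT (h u) ?Duw ?orbT // h // symD Duw.
exists g; apply: (@good_of_delete v) => //.
- have fv w : w \in W -> (g v == g w) = connect D v w.
    move=> wW; rewrite connect_isolated // eq_sym gv.
    case: (delete_cases v wW) => [->|->|wX].
    + by rewrite gv !eqxx.
    + by rewrite gsv [v == _]eq_sym (negbTE nsv); lia.
    + by rewrite gd //; move: wX; rewrite in_delete eq_sym => /and3P[/negbTE-> _ _]; lia.
  have fsv w : w \in W -> (g (s v) == g w) = connect D (s v) w.
    move=> wW; rewrite connect_isolated // eq_sym gsv.
    case: (delete_cases v wW) => [->|->|wX].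
    + by rewrite gv (negbTE nsv); lia.
    + by rewrite gsv !eqxx.
    + by rewrite gd //; move: wX; rewrite in_delete [w == s v]eq_sym => /and3P[_ /negbTE-> _]; lia.
  move=> u w uW wW; case: (delete_cases v uW) => [->|->|uX]; [exact: fv|exact: fsv|].
  case: (delete_cases v wW) => [->|->|wX].
  + by rewrite eq_sym fv // symc.
  + by rewrite eq_sym fsv // symc.
  + by rewrite (eq_connect eqD) -fib // !gd //; lia.
- move=> u uX h; rewrite gv gsv !gd ?delete_s // -(cut u) //.
  by congr (_ (+) _); lia.
- move=> u w uX wX h; rewrite !gd ?delete_s // -(ed _ _ uX wX h).
  by congr (_ (+) _); lia.
Qed.

(** The selected double edge forces [s v] to take the value of [s a], so only the threshold [k] of
    [v] remains free. *)
Lemma extend_leaf v a f k : v \in W -> s v != v -> a \in delete v ->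
  (forall u, ~~ D v u) -> (forall u, D (s v) u = (u == s a)) ->
  good (delete v) t1 t2 (induced (delete v) D) e f ->
  {in delete v, forall u, t1 v u (+) t2 v u ->
     (k <= f u) (+) (f (s a) < f (s u)) = t2 v u (+) e} ->
  exists g, good W t1 t2 D e g.
Proof.
move=> vW nsv aX isov leaf [fib ed] cut.
(* [pi] glues [s v] to [s a]; odd values are reserved for [v]. *)
pose pi u := if u == s v then s a else u.
pose g u := if u == v then 2 * k + 1 else 2 * f (pi u) + 2.
have gv : g v = 2 * k + 1 by rewrite /g eqxx.
have gsv : g (s v) = 2 * f (s a) + 2 by rewrite /g /pi (negbTE nsv) eqxx.
have gd u : u \in delete v -> g u = 2 * f u + 2.
  by rewrite in_delete => /and3P[/negbTE n1 /negbTE n2 _]; rewrite /g /pi n1 n2.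
have symc : connect_sym D by apply: sym_connect_sym.
have saX : s a \in delete v by rewrite delete_s.
have piX u : u \in W -> u != v -> pi u \in delete v.
  by rewrite /pi; case: ifPn => // nu uW nuv; rewrite in_delete nuv nu.
have connE u w : connect D u w = connect (induced (delete v) D) (pi u) (pi w).
  rewrite (connect_pendant symD _ leaf); last first.
    by apply: contraTneq saX => <-; rewrite in_delete eqxx andbF.
  rewrite -/(pi u) -/(pi w); apply: eq_connect => x y; rewrite /induced !in_delete.
  case Dxy: (D x y); rewrite ?andbF ?andbT //; have [-> -> _ _] := subD Dxy.
  have nx : x != v by apply: contraTneq Dxy => ->; apply: isov.
  have ny : y != v by apply: contraTneq Dxy => ->; rewrite symD; apply: isov.
  by rewrite nx ny !andbT.
exists g; apply: (@good_of_delete v) => //.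
- have fv w : w \in W -> (g v == g w) = connect D v w.
    move=> wW; rewrite connect_isolated // eq_sym gv.
    have [->|nw] := eqVneq w v; first by rewrite gv !eqxx.
    by rewrite /g (negbTE nw); lia.
  move=> u w uW wW; have [->|nu] := eqVneq u v; first exact: fv.
  have [->|nw] := eqVneq w v; first by rewrite eq_sym fv // symc.
  rewrite connE -fib; try exact: piX.
  by rewrite /g (negbTE nu) (negbTE nw); lia.
- move=> u uX h; rewrite gv gsv !gd ?delete_s // -(cut u) //.
  by congr (_ (+) _); lia.
- move=> u w uX wX h; rewrite !gd ?delete_s // -(ed _ _ uX wX h).
  by congr (_ (+) _); lia.
Qed.

End Frame.

Lemma conj_eq u w : (s u == w) = (u == s w).
Proof. by rewrite -[s u == w](inj_eq s_inj) sK. Qed.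

Lemma pair_rel_conj a b u w : pair_rel a b (s u) (s w) = pair_rel (s a) (s b) u w.
Proof.
by rewrite /pair_rel !conj_eq.
Qed.

(** The exclusive or tells apart the two pairs of opposite quadrants cut out by [k] and [k']. A cut
    in the first coordinate suffices, with the other threshold below or above all values. *)
Lemma separating_cut (xa xb xc ya yb yc : nat) e :
  (xc < xa) && (xc < xb) || (xa < xc) && (xb < xc) -> exists k k',
  [/\ (k <= xa) (+) (k' <= ya) = e, (k <= xb) (+) (k' <= yb) = e
    & (k <= xc) (+) (k' <= yc) = ~~ e].
Proof.
case/orP => /andP[h1 h2].
  by exists xc.+1, (if e then (ya + yb + yc).+1 else 0); case: e; split; lia.
by exists (maxn xa xb).+1, (if e then 0 else (ya + yb + yc).+1); case: e; split; lia.
Qed.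

(* [a] and [b] are opposite corners of a box; if [c] lies in it, cut through
   the box so that [c] alone is in one of the two remaining quadrants. *)
Lemma box_cut (xa xb xc ya yb yc : nat) e :
  xa != xb -> ya != yb -> (xa < xb) (+) (ya < yb) = e ->
  (xc != xa) || (yc != ya) -> (xc != xb) || (yc != yb) -> exists k k',
  [/\ (k <= xa) (+) (k' <= ya) = e, (k <= xb) (+) (k' <= yb) = e
    & (k <= xc) (+) (k' <= yc) = ~~ e].
Proof.
move=> nx ny he nca ncb.
have [|nsx] := boolP ((xc < xa) && (xc < xb) || (xa < xc) && (xb < xc)).
  exact: separating_cut.
have [hs|nsy] := boolP ((yc < ya) && (yc < yb) || (ya < yc) && (yb < yc)).
  have [k [k' [h1 h2 h3]]] := separating_cut xa xb xc e hs.
  by exists k', k; split; rewrite addbC.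
wlog ltx : xa xb ya yb nx ny he nca ncb nsx nsy / xa < xb.
  move=> wl; have [lt|lt|eqx] := ltngtP xa xb; first exact: wl.
    have [|||||||k [k' [h1 h2 h3]]] := wl xb xa yb ya _ _ _ _ _ _ _ lt => //.
    - by rewrite eq_sym.
    - by rewrite eq_sym.
    - by move: he nx ny; clear; case: e; lia.
    - by rewrite andbC [X in _ || X]andbC.
    - by rewrite andbC [X in _ || X]andbC.
    by exists k, k'.
  by rewrite eqx eqxx in nx.
have {}nsx : xa <= xc <= xb by move: nsx ltx; clear; lia.
rewrite ltx in he; case: e he => /= he.
  have {}nsy : yb <= yc <= ya by move: nsy he ny; clear; case: ltngtP => //; lia.
  (* Here [a] is the upper left corner and [b] the lower right one. If [c] avoids the right and
     upper sides, it ends up below both thresholds; otherwise it ends up above both. *)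
  have [/andP[h1 h2]|h] := boolP ((xc < xb) && (yc < ya)).
    exists xb, ya; rewrite leqnn.
    have -> : xb <= xa = false by lia.
    have -> : xb <= xc = false by lia.
    have -> : ya <= yb = false by lia.
    have -> : ya <= yc = false by lia.
    by rewrite !leqnn.
  exists xa.+1, yb.+1; rewrite !ltnn ltx.
  have -> : yb < ya by lia.
  have -> : xa < xc by lia.
  have -> : yb < yc by lia.
  by [].
have {}nsy : ya <= yc <= yb by move: nsy he ny; clear; case: ltngtP => //; lia.
(* In the mirrored case [c] ends up alone in the upper left or in the lower right quadrant. *)
have [/andP[h1 h2]|h] := boolP ((xc < xb) && (ya < yc)).
  exists xb, ya.+1; rewrite leqnn ltnn h2.
  have -> : xb <= xa = false by lia.
  have -> : xb <= xc = false by lia.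
  have -> : ya < yb by lia.
  by [].
exists xa.+1, yb; rewrite leqnn ltnn ltx.
have -> : xa < xc by lia.
have -> : yb <= ya = false by lia.
have -> : yb <= yc = false by lia.
by [].
Qed.

(** Undoes the identification of [a] and [b] inside their fibre, with their order prescribed by
    [o]. *)
Lemma split_fibres X D a b f (o : bool) : symmetric D -> a \in X -> b \in X ->
  ~~ connect D a b -> fibres X (add_edge D a b) f ->
  exists g, [/\ fibres X D g, forall u w, f u < f w -> g u < g w & (g a < g b) = o].
Proof.
move=> symD aX bX nab fib; have symc : connect_sym D by apply: sym_connect_sym.
have fab : f a = f b.
  by apply/eqP; rewrite fib // connect1 // /add_edge /pair_rel !eqxx orbT.
(* One component, that of [b] or that of [a], is raised by one; doubling [f] preserves its strict
   inequalities. *)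
exists (fun u => 2 * f u + connect D (if o then b else a) u); split.
- move=> u w uX wX.
  have -> : (2 * f u + connect D (if o then b else a) u ==
    2 * f w + connect D (if o then b else a) w) = ((f u == f w) &&
    (connect D (if o then b else a) u == connect D (if o then b else a) w)) by lia.
  rewrite fib // connect_add_edge //.
  have [c|nc] := boolP (connect D u w).
    by rewrite /= [connect D _ u]symc [connect D _ w]symc (same_connect symc c) eqxx.
  apply/negbTE/negP => /= /andP[/orP[] /andP[c1 c2] /eqP eqc]; case/negP: nc.
    case: o eqc => /=; rewrite ?c2 => eqc.
      by apply: connect_trans (c2); rewrite symc eqc.
    by apply: (connect_trans c1); rewrite -eqc symc.
  case: o eqc => /=; rewrite ?c2 => eqc.
    by apply: (connect_trans c1); rewrite -eqc symc.
  by apply: connect_trans (c2); rewrite symc eqc.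
- by move=> u w; lia.
rewrite fab; case: o; first by rewrite symc (negbTE nab) connect0; lia.
by rewrite (negbTE nab) connect0; lia.
Qed.

(** * The inductive step: a vertex of degree at most 3 *)

Section Step.
Variables (W : {set V}) (t1 t2 D : rel V) (e : bool).
Hypothesis fr : frame W t1 t2 D.
Hypothesis IH : forall W' t1' t2' D', #|W'| < #|W| -> frame W' t1' t2' D' ->
  exists f, good W' t1' t2' D' e f.

Let g1 := fr_g1 fr.
Let g2 := fr_g2 fr.
Let sW := fr_s fr.
Let subD := sel_sub (fr_sel fr).

Lemma isolated_of_simple v : {in W, forall u, ~~ (t1 v u && t2 v u)} ->
  (forall u, ~~ D v u) /\ (forall u, ~~ D (s v) u).
Proof.
move=> simple; split=> u; apply/negP => /subD[vW uW h1 h2].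
  by have := simple u uW; rewrite h1 h2.
have := simple (s u); rewrite sW => /(_ uW).
by rewrite -(sg_inv g1) -(sg_inv g2) sK h1 h2.
Qed.

Lemma nbr_in_delete v u : u \in W -> t1 v u || t2 v u -> u \in delete W v.
Proof.
move=> uW adj; rewrite in_delete uW andbT; apply/andP; split.
  by apply: contraTneq adj => ->; rewrite (sg_irr g1) (sg_irr g2).
apply: contraTneq adj => ->.
by rewrite (negbTE (sg_fix g1 v)) (negbTE (sg_fix g2 v)).
Qed.


Lemma nbr_conj t v a : sym_graph t -> {in W, forall u, t v u = (u == a)} ->
  {in W, forall u, t (s v) u = (u == s a)}.
Proof.
by move=> gt nbr u uW; rewrite -(sg_inv gt) sK nbr ?sW // conj_eq.
Qed.

Lemma step_no_t2 v : v \in W -> s v != v -> {in W, forall u, ~~ t2 v u} ->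
  exists g, good W t1 t2 D e g.
Proof.
move=> vW nsv no2.
have [|isov isosv] := @isolated_of_simple v.
  by move=> u uW; rewrite (negbTE (no2 u uW)) andbF.
have [f gd] := IH (card_delete vW) (frame_delete fr v).
(* All edges at [v] want the same colour, so [v] goes to an extreme corner: [0] is below all values,
   the maximum plus one above them. *)
apply: (extend_free (k := 0) (k' := if e then (\max_u f u).+1 else 0) fr vW nsv isov isosv gd).
move=> u uX; rewrite (negbTE (no2 u _)) ?(subsetP (delete_sub W v)) // => _.
by case: (e) => //=; rewrite leqNgt ltnS leq_bigmax.
Qed.

(** Since [D] contains the conjugate of [va], it does not contain [va], the only possible double
    edge at [v]. *)
Lemma leaf_nbrs v a : {in W, forall u, t2 v u = (u == a)} -> a \in W -> D (s v) (s a) ->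
  (forall u, ~~ D v u) /\ (forall u, D (s v) u = (u == s a)).
Proof.
move=> nbr aW Dsa; split=> u.
  apply/negP => Dvu; have [vW uW h1 h2] := subD Dvu.
  have := h2; rewrite nbr // => /eqP E; subst u.
  by have := sel_xor (fr_sel fr) vW uW h1 h2; rewrite Dvu Dsa.
apply/idP/eqP => [/subD[_ uW _]|->//]; rewrite (nbr_conj g2 nbr) //.
by move/eqP.
Qed.

Lemma step_pair v a c : v \in W -> s v != v -> a \in W -> c \in W ->
  {in W, forall u, t1 v u = (u == a)} -> {in W, forall u, t2 v u = (u == c)} ->
  exists g, good W t1 t2 D e g.
Proof.
move=> vW nsv aW cW nbr1 nbr2.
have dW x : x \in delete W v -> x \in W by apply: (subsetP (delete_sub W v)).
have [E|nac] := eqVneq a c.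
  (* Exchanging [v] and [s v] if necessary, the selected copy of the double edge is the one at
     [s v]. *)
  subst c; wlog Dsa : v a vW nsv aW cW nbr1 nbr2 dW / D (s v) (s a).
    move=> wl; have := sel_xor (fr_sel fr) vW aW.
    rewrite nbr1 // nbr2 // eqxx => /(_ isT isT).
    case Dsa: (D (s v) (s a)); first by move=> _; apply: (wl v a).
    rewrite addbF => Dva; apply: (wl (s v) (s a)); rewrite ?sW ?sK //.
    - by rewrite eq_sym.
    - exact: nbr_conj.
    - exact: nbr_conj.
    - by move=> x; rewrite delete_conj; apply: dW.
  have [isov leaf] := leaf_nbrs nbr2 aW Dsa.
  have [f gd] := IH (card_delete vW) (frame_delete fr v).
  (* No simple edge leaves [v], so any threshold would do. *)
  apply: (extend_leaf (k := 0) fr vW nsv _ isov leaf gd).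
    by rewrite nbr_in_delete // nbr1 // eqxx.
  by move=> u /dW uW; rewrite nbr1 // nbr2 // addbb.
have [|isov isosv] := @isolated_of_simple v.
  move=> u uW; rewrite nbr1 // nbr2 //.
  by apply/negP => /andP[/eqP-> E]; rewrite E in nac.
have [f gd] := IH (card_delete vW) (frame_delete fr v); have [fib _] := gd.
have aX : a \in delete W v by rewrite nbr_in_delete // nbr1 // eqxx.
have cX : c \in delete W v by rewrite nbr_in_delete // nbr2 // eqxx orbT.
(* By injectivity [a] and [c] differ in some coordinate, and a cut there separates them; [a] is
   entered twice to fit [separating_cut]. *)
have [k [k' [h1 _ h2]]] : exists k k',
    [/\ (k <= f a) (+) (k' <= f (s a)) = e, (k <= f a) (+) (k' <= f (s a)) = e
      & (k <= f c) (+) (k' <= f (s c)) = ~~ e].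
  have [nf|/negPn/eqP Ef] := boolP (f a != f c); first by apply: separating_cut; lia.
  have [k' [k [h1 h2 h3]]] : exists k' k,
      [/\ (k' <= f (s a)) (+) (k <= f a) = e, (k' <= f (s a)) (+) (k <= f a) = e
      & (k' <= f (s c)) (+) (k <= f c) = ~~ e].
    apply: separating_cut; suff : f (s a) != f (s c) by lia.
    apply: contra nac => /eqP Es; apply/eqP.
    exact: (fibres_inj (frame_delete fr v) fib).
  by exists k, k'; split; rewrite addbC.
apply: (extend_free (k := k) (k' := k') fr vW nsv isov isosv gd).
move=> u /dW uW; rewrite nbr1 // nbr2 //.
have [->|nua] := eqVneq u a; first by rewrite (negbTE nac).
by have [->|//] := eqVneq u c.
Qed.

(** The vertex [v] has total degree 3; [c] may coincide with [a] or [b]. *)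
Record fork v a b c : Prop := Fork {
  fk_v : v \in W;
  fk_sv : s v != v;
  fk_a : a \in W;
  fk_b : b \in W;
  fk_c : c \in W;
  fk_ab : a != b;
  fk_1 : {in W, forall u, t1 v u = (u == a) || (u == b)};
  fk_2 : {in W, forall u, t2 v u = (u == c)} }.

Lemma fork_swap v a b c : fork v a b c -> fork v b a c.
Proof.
case=> ? ? ? ? ? ? h1 ?; split=> //; first by rewrite eq_sym.
by move=> u uW; rewrite orbC h1.
Qed.

Lemma fork_conj v a b c : fork v a b c -> fork (s v) (s a) (s b) (s c).
Proof.
case=> vW nsv aW bW cW nab h1 h2; split; rewrite ?sW ?sK ?(inj_eq s_inj) //.
- by rewrite eq_sym.
- by move=> u uW; rewrite -(sg_inv g1) sK h1 ?sW // !conj_eq.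
- exact: nbr_conj.
Qed.

(** * Suppressing a vertex with two neighbours in one forest *)

Section Fork.
Variables (v a b c : V).
Hypothesis fk : fork v a b c.

Let vW := fk_v fk.
Let aW := fk_a fk.
Let bW := fk_b fk.
Let tva : t1 v a. Proof. by rewrite (fk_1 fk) ?eqxx. Qed.
Let tvb : t1 v b. Proof. by rewrite (fk_1 fk) ?eqxx ?orbT. Qed.
Let aX : a \in delete W v. Proof. by rewrite nbr_in_delete ?tva. Qed.
Let bX : b \in delete W v. Proof. by rewrite nbr_in_delete ?tvb. Qed.
Let dW u : u \in delete W v -> u \in W. Proof. exact: (subsetP (delete_sub W v)). Qed.

(** Otherwise [v], [a], [b] would form a triangle in [t1]. So joining [a] to [b] adds a genuinely
    new edge. *)
Lemma fork_triangle_free : ~~ t1 a b.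
Proof.
apply/negP => tab; apply: (@forest_two_nbrs _ t1 W [set v; a; b] (fr_f1 fr)).
- by rewrite !subUset !sub1set vW aW bW.
- by apply/set0Pn; exists v; rewrite !inE eqxx.
have nva : v != a by apply: contraTneq tva => ->; rewrite (sg_irr g1).
have nvb : v != b by apply: contraTneq tvb => ->; rewrite (sg_irr g1).
move=> x; rewrite !inE -orbA => /or3P[] /eqP->.
- by exists a, b; rewrite !inE !eqxx !orbT tva tvb (fk_ab fk).
- by exists v, b; rewrite !inE !eqxx !orbT (sg_sym g1) tva tab nvb.
- by exists v, a; rewrite !inE !eqxx !orbT !(sg_sym g1 b) tvb tab nva.
Qed.

(** Otherwise [v], [a], [s v], [s a] would form a 4-cycle in [t1]. So the new edge does not join a
    vertex to its image. *)
Lemma fork_not_conj : b != s a.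
Proof.
apply/eqP => Eb; have tvsa : t1 v (s a) by rewrite -Eb.
have tsva : t1 (s v) a by rewrite -(sg_inv g1) sK.
have tsvsa : t1 (s v) (s a) by rewrite (sg_inv g1).
have nab : a != s a by rewrite -Eb (fk_ab fk).
have nsv : v != s v by rewrite eq_sym (fk_sv fk).
apply: (@forest_two_nbrs _ t1 W [set v; s v; a; s a] (fr_f1 fr)).
- by rewrite !subUset !sub1set !sW vW aW.
- by apply/set0Pn; exists v; rewrite !inE eqxx.
move=> x; rewrite !inE -!orbA => /or4P[] /eqP->.
- by exists a, (s a); rewrite !inE !eqxx !orbT tva tvsa nab.
- by exists a, (s a); rewrite !inE !eqxx !orbT tsva tsvsa nab.
- by exists v, (s v); rewrite !inE !eqxx !orbT !(sg_sym g1 a) tva tsva nsv.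
- by exists v, (s v); rewrite !inE !eqxx !orbT !(sg_sym g1 (s a)) tvsa tsvsa nsv.
Qed.

Definition joined := add_edge (add_edge t1 a b) (s a) (s b).

Lemma joined_spec u w :
  joined u w = [|| t1 u w, pair_rel a b u w | pair_rel (s a) (s b) u w].
Proof. by rewrite /joined /add_edge orbA. Qed.

(** The two new edges could coincide only if [b] were [s a], or if [a] and [b] were both fixed,
    against [fr_fix]. *)
Lemma fork_pair_excl u w : pair_rel a b u w -> ~~ pair_rel (s a) (s b) u w.
Proof.
move=> /pair_relP h; apply/negP => /pair_relP h'.
have nab := fk_ab fk; have nc := fork_not_conj.
have fix_ab : a = s a -> b = s b -> False.
  move=> Ea Eb; move: nab; rewrite (fr_fix fr aW bW (esym Ea) (esym Eb)).
  by rewrite eqxx.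
case: h h' => -[-> ->] [] [Ea Eb]; try exact: fix_ab.
- by rewrite Eb eqxx in nc.
- by rewrite -Ea eqxx in nc.
Qed.

Lemma joined_graph : sym_graph joined.
Proof.
have nc := fork_not_conj; have nab := fk_ab fk.
split.
- by move=> u w; rewrite !joined_spec (sg_sym g1) !(pair_relC _ _ u).
- move=> u; rewrite joined_spec (sg_irr g1) /=; apply/norP; split.
    by apply: contra nab => /pair_relP[] [<- <-].
  by rewrite -(inj_eq s_inj) in nab; apply: contra nab => /pair_relP[] [<- <-].
- move=> u w; rewrite !joined_spec (sg_inv g1) !pair_rel_conj !sK.
  by congr (_ || _); rewrite orbC.
move=> u; rewrite joined_spec (negbTE (sg_fix g1 u)) -pair_rel_conj sK /=.
rewrite pair_relC orbb; apply: contra nc => /pair_relP[] [].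
  by move=> <- <-; rewrite sK.
by move=> <- <-.
Qed.

(** Suppress [v] first and then [s v], which is still adjacent to [s a] and [s b]. *)
Lemma joined_forest : forest joined (delete W v).
Proof.
have nsv : s v \in W :\ v by rewrite !inE (fk_sv fk) sW vW.
apply: (forest_suppress (t := add_edge t1 a b) _ _ nsv).
- exact: (forest_suppress (fr_f1 fr) (sg_sym g1) vW (fk_ab fk) tva tvb).
- by move=> u w; rewrite /add_edge (sg_sym g1) pair_relC.
- by rewrite (inj_eq s_inj) (fk_ab fk).
- by rewrite /add_edge (sg_inv g1) tva.
- by rewrite /add_edge (sg_inv g1) tvb.
Qed.

Let D0 := induced (delete W v) D.
Let fr0 := frame_delete fr v.

(** The new edges are not in [t2], so no double edge arises and the selection is kept. *)
Lemma frame_joined_single : ~~ t2 a b -> frame (delete W v) joined t2 D0.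
Proof.
move=> nt2; case: (fr0) => ss sf _ _ _ f2 [sy sb sx]; split=> //.
- exact: joined_graph.
- exact: joined_forest.
split=> // u w; first by case/sb => -> -> h1 h2; rewrite joined_spec h1.
move=> uX wX; rewrite joined_spec => /orP[h1 h2|]; first exact: sx.
have nt2' : ~~ t2 (s a) (s b) by rewrite (sg_inv g2).
case/orP => /pair_relP[] [-> ->]; first by rewrite (negbTE nt2).
- by rewrite (sg_sym g2) (negbTE nt2).
- by rewrite (negbTE nt2').
- by rewrite (sg_sym g2) (negbTE nt2').
Qed.

(** Both new edges become double, and [ab] is the one selected. *)
Lemma frame_joined_double : t2 a b -> frame (delete W v) joined t2 (add_edge D0 a b).
Proof.
move=> t2ab; case: (fr0) => ss sf _ _ _ f2 [sy sb sx]; split=> //.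
- exact: joined_graph.
- exact: joined_forest.
have nt1 x y : pair_rel a b x y -> ~~ D0 x y.
  move=> p; apply/negP => /sb[_ _ h _]; move: h (fork_triangle_free).
  by case/pair_relP: p => -[-> ->]; rewrite 1?(sg_sym g1) => ->.
have nt1' x y : pair_rel (s a) (s b) x y -> ~~ D0 x y.
  move=> p; apply/negP => /sb[_ _ h _]; move: h (fork_triangle_free).
  by case/pair_relP: p => -[-> ->]; rewrite (sg_inv g1) 1?(sg_sym g1) => ->.
split.
- by move=> u w; rewrite /add_edge pair_relC; congr (_ || _); apply: sy.
- move=> u w /orP[/sb[-> -> h1 h2]|p]; first by rewrite joined_spec h1.
  rewrite joined_spec p orbT; case/pair_relP: p => -[-> ->] //.
  by rewrite (sg_sym g2).
move=> u w uX wX; rewrite joined_spec /add_edge !pair_rel_conj => /or3P[] h h2.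
- have np : ~~ pair_rel a b u w.
    apply/negP => p; move: h (fork_triangle_free).
    by case/pair_relP: p => -[-> ->]; rewrite 1?(sg_sym g1) => ->.
  have np' : ~~ pair_rel (s a) (s b) u w.
    apply/negP => p; move: h (fork_triangle_free).
    by case/pair_relP: p => -[-> ->]; rewrite (sg_inv g1) 1?(sg_sym g1) => ->.
  by rewrite (negbTE np) (negbTE np') !orbF; apply: sx.
- have np' := fork_pair_excl h; rewrite h orbT (negbTE np') orbF.
  by apply: nt1'; rewrite -pair_rel_conj !sK.
rewrite h orbT (negbTE (nt1' _ _ h)) /=.
by rewrite addbT; apply/negP => p; move: (fork_pair_excl p); rewrite h.
Qed.

(** In the auxiliary frame the new edge is simple, so its colour makes [a] and [b] opposite corners
    of a box of known orientation, as [box_cut] requires. *)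
Lemma fork_single : ~~ t2 a b -> exists f,
  [/\ good (delete W v) t1 t2 D0 e f, f a != f b, f (s a) != f (s b)
    & (f a < f b) (+) (f (s a) < f (s b)) = e].
Proof.
move=> nt2; have fr' := frame_joined_single nt2.
have [f [fib ed]] := IH (card_delete vW) fr'.
have jab : joined a b (+) t2 a b.
  by rewrite joined_spec (negbTE nt2) /pair_rel !eqxx orbT.
have [n1 n2] := frame_xor_neq fr' fib aX bX jab.
have := ed _ _ aX bX jab; rewrite (negbTE nt2) => eab.
exists f; split=> //; split=> // u w uX wX h; apply: ed => //.
have := h; rewrite joined_spec; case h1: (t1 u w) => //=.
move=> h2; rewrite h2 addbT; apply/norP; split; apply/negP => /pair_relP p.
  by case: p h2 => -[-> ->]; rewrite ?(negbTE nt2) // (sg_sym g2) (negbTE nt2).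
case: p h2 => -[-> ->]; rewrite (sg_inv g2) ?(negbTE nt2) //.
by rewrite (sg_sym g2) (negbTE nt2).
Qed.

(** The auxiliary solution identifies [a] and [b]; without the new edge, [ab] is simple in [t2] and
    its ends must be separated. A vertex that was not level with them stays strictly to one side of
    both. *)
Lemma fork_double : t2 a b -> exists2 g, good (delete W v) t1 t2 D0 e g &
  {in delete W v, forall x, ~~ connect (add_edge D0 a b) a x ->
     (g x < g a) && (g x < g b) || (g a < g x) && (g b < g x)}.
Proof.
move=> t2ab; have fr' := frame_joined_double t2ab.
have [f [fib ed]] := IH (card_delete vW) fr'.
have symD0 : symmetric D0 := sel_sym (fr_sel fr0).
have saX : s a \in delete W v by rewrite (delete_s fr).
have sbX : s b \in delete W v by rewrite (delete_s fr).
have jab : joined a b by rewrite joined_spec /pair_rel !eqxx orbT.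
have Dab : add_edge D0 a b a b by rewrite /add_edge /pair_rel !eqxx orbT.
have fab : f a = f b by apply/eqP; rewrite fib // connect1.
(* The conjugate of the selected edge is not selected, and it is a bridge of [t2]. *)
have nfs : f (s a) != f (s b).
  rewrite fib //; have [symD' subD' xorD'] := fr_sel fr'.
  apply: (forest_edge_bridge (sg_sym g2) (sg_irr g2) (fr_f2 fr')) => //.
  - by move=> x y /subD'[-> ->].
  - by rewrite (sg_inv g2).
  - by have := xorD' _ _ aX bX jab t2ab; rewrite Dab.
have nab : ~~ connect D0 a b.
  apply: (forest_edge_bridge (sg_sym g2) (sg_irr g2) (fr_f2 fr0)) => //.
    by move=> x y /(sel_sub (fr_sel fr0))[-> ->].
  by apply: contra (fork_triangle_free) => /(sel_sub (fr_sel fr0))[].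
(* The order of [g a] and [g b] is chosen so that [ab] gets the colour of [t2]. *)
have [g [fibg mono gab]] :=
  split_fibres (~~ e (+) (f (s a) < f (s b))) symD0 aX bX nab fib.
(* The ends of a simple edge of the auxiliary frame differ in both coordinates, so passing from [f]
   to [g] keeps its colour. *)
have monoE x y : f x != f y -> (g x < g y) = (f x < f y).
  case: (ltngtP (f x) (f y)) => // lt _; first by rewrite mono.
  by apply/negbTE; rewrite -leqNgt ltnW // mono.
exists g; last first.
  move=> x xX nc; rewrite -fib // in nc.
  move: nc (mono x a) (mono x b) (mono a x) (mono b x); rewrite -fab neq_ltn.
  by case/orP => lt h1 h2 h3 h4; [rewrite h3 // h4 // orbT | rewrite h1 // h2].
split=> // u w uX wX h.
have okab : edge_ok t1 t2 e g a b.
  by move=> _; rewrite gab monoE // t2ab -addbA addbb addbF.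
have oksab : edge_ok t1 t2 e g (s a) (s b).
  by move=> _; rewrite !sK addbC okab ?(sg_inv g2) // (negbTE fork_triangle_free).
have [p|np] := boolP (pair_rel a b u w).
  case/pair_relP: p h => -[-> ->]; first exact: okab.
  exact: (edge_ok_sym fr0 fibg aX bX okab).
have [p|np'] := boolP (pair_rel (s a) (s b) u w).
  case/pair_relP: p h => -[-> ->]; first exact: oksab.
  exact: (edge_ok_sym fr0 fibg saX sbX oksab).
have h' : joined u w (+) t2 u w by rewrite joined_spec (negbTE np) (negbTE np') !orbF.
have [n1 n2] := frame_xor_neq fr' fib uX wX h'.
by rewrite !monoE //; apply: ed.
Qed.

Lemma fork_cut f k k' : c != a -> c != b -> good (delete W v) t1 t2 D0 e f ->
  (k <= f a) (+) (k' <= f (s a)) = e -> (k <= f b) (+) (k' <= f (s b)) = e ->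
  (k <= f c) (+) (k' <= f (s c)) = ~~ e -> exists g, good W t1 t2 D e g.
Proof.
move=> nca ncb gd ea eb ec.
have [|isov isosv] := @isolated_of_simple v.
  move=> u uW; rewrite (fk_1 fk) // (fk_2 fk) //; apply/negP => /andP[+ /eqP Eu].
  by rewrite Eu (negbTE nca) (negbTE ncb).
apply: (extend_free fr vW (fk_sv fk) isov isosv gd (k := k) (k' := k')).
move=> u /dW uW; rewrite (fk_1 fk) // (fk_2 fk) //.
have [->|nua] := eqVneq u a; first by rewrite [a == c]eq_sym (negbTE nca).
have [->|nub] := eqVneq u b; first by rewrite [b == c]eq_sym (negbTE ncb) orbT.
by have [->|//] := eqVneq u c.
Qed.

(** As [s v] takes the value of [s a], only the edge [vb] still imposes a condition. *)
Lemma fork_leaf f k : c = a -> D (s v) (s a) -> good (delete W v) t1 t2 D0 e f ->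
  (k <= f b) (+) (f (s a) < f (s b)) = e -> exists g, good W t1 t2 D e g.
Proof.
move=> Eca Dsa gd eb.
have nbr2 : {in W, forall u, t2 v u = (u == a)} by rewrite -Eca; apply: (fk_2 fk).
have [isov leaf] := leaf_nbrs nbr2 aW Dsa.
apply: (extend_leaf fr vW (fk_sv fk) aX isov leaf gd (k := k)).
move=> u /dW uW; rewrite (fk_1 fk) // nbr2 //.
have [->//|nua] := eqVneq u a.
by have [->|] := eqVneq u b.
Qed.

(** Otherwise [c] would be connected to [a] or [b] by [D0], and also by the conjugate of [D0]
    together with [ab]. These are edge-disjoint in the forest [t2], so [c] would equal [a] or
    [b]. *)
Lemma fork_not_collinear : t2 a b -> c != a -> c != b ->
  ~~ (connect (add_edge D0 a b) a c && connect (add_edge D0 (s a) (s b)) (s a) (s c)).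
Proof.
move=> t2ab nca ncb; apply/negP; rewrite connect_conj => /andP[c1 c2].
have [_ subD0 xorD0] := fr_sel fr0; have symD0 : symmetric D0 := sel_sym (fr_sel fr0).
have apart x : connect D0 x c ->
    connect (fun y z => add_edge D0 (s a) (s b) (s y) (s z)) x c -> x = c.
  move=> d1 d2.
  apply: (forest_connect_disjoint (sg_sym g2) (fr_f2 fr0) _ _ _ _ _ d1 d2) => y z.
  - by move=> /subD0[-> ->].
  - rewrite /add_edge -pair_rel_conj !sK => /orP[/subD0[]|/pair_relP[] [-> ->]].
    + by rewrite !(delete_s fr) (sg_inv g2) => -> ->.
    + by rewrite aX bX.
    + by rewrite aX bX (sg_sym g2).
  - by rewrite symD0.
  - by rewrite /add_edge symD0 pair_relC.
  move=> Dyz; have [yX zX h1 h2] := subD0 _ _ Dyz.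
  have := xorD0 _ _ yX zX h1 h2; rewrite -/D0 Dyz addTb /add_edge -pair_rel_conj !sK.
  move=> /negbTE-> /=; apply: contra fork_triangle_free => /pair_relP p.
  by case: p h1 => -[-> ->] //; rewrite (sg_sym g1).
have cba : connect (fun y z => add_edge D0 (s a) (s b) (s y) (s z)) b a.
  by apply: connect1; rewrite /add_edge -pair_rel_conj !sK /pair_rel !eqxx !orbT.
move: c1; rewrite connect_add_edge //; case/or3P => [c1|/andP[_ c1]|/andP[_ c1]].
- by rewrite -(apart a) ?eqxx in nca.
- by rewrite -(apart b) ?eqxx // in ncb; apply: connect_trans cba c2.
- by rewrite -(apart a) ?eqxx in nca.
Qed.

End Fork.

Lemma step_fork v a b c : fork v a b c -> exists g, good W t1 t2 D e g.
Proof.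
move=> fk.
have [vW aW bW cW] := And4 (fk_v fk) (fk_a fk) (fk_b fk) (fk_c fk).
have [cab|] := boolP ((c == a) || (c == b)).
  wlog Eca : a b fk aW bW cab / c = a.
    move=> wl; case/orP: (cab) => /eqP E; first exact: (wl a b).
    by apply: (wl b a) => //; [exact: fork_swap | rewrite orbC].
  clear cab; subst c.
  wlog Dsa : v a b fk vW aW bW cW / D (s v) (s a).
    move=> wl.
    have := sel_xor (fr_sel fr) vW aW; rewrite (fk_1 fk) // (fk_2 fk) // eqxx => /(_ isT isT).
    case Dsa: (D (s v) (s a)); first by move=> _; apply: (wl v a b).
    rewrite addbF => Dva; apply: (wl _ _ _ (fork_conj fk)); rewrite ?sW //.
    by rewrite !sK.
  have [t2ab|nt2ab] := boolP (t2 a b).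
    have [g gd _] := fork_double fk t2ab; have [_ ed] := gd.
    have [aX bX] : a \in delete W v /\ b \in delete W v.
      by split; apply: nbr_in_delete; rewrite // (fk_1 fk) // eqxx ?orbT.
    have := ed _ _ aX bX; rewrite /edge_ok t2ab (negbTE (fork_triangle_free fk)).
    move=> /(_ isT) eab.
    (* The edge [ab] has the colour of [t2] and [vb] needs the other one, so [v] and [a] go to
       opposite sides of [b]. *)
    apply: (fork_leaf fk (k := if g a < g b then (g b).+1 else 0) erefl Dsa gd).
    by move: eab; case: (g a < g b); rewrite ?ltnn /=; case: (_ < _); case: (e).
  have [f [gd nab nsab eab]] := fork_single fk nt2ab.
  (* Here [a] is on the correct side of [b] for the colour of [t1], and [v] joins it there. *)
  apply: (fork_leaf fk (k := if f a < f b then 0 else (f b).+1) erefl Dsa gd).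
  by move: eab; case: (f a < f b); rewrite ?ltnn.
case/norP => nca ncb; have [t2ab|nt2ab] := boolP (t2 a b); last first.
  have [f [gd nab nsab eab]] := fork_single fk nt2ab; have [fib _] := gd.
  have inX x : (x == a) || (x == b) || (x == c) -> x \in delete W v.
    move=> h; have xW : x \in W by case/orP: h => [/orP[]|] /eqP->.
    by apply: nbr_in_delete; rewrite // (fk_1 fk) // (fk_2 fk).
  have apart x : (x == a) || (x == b) -> c != x -> (f c != f x) || (f (s c) != f (s x)).
    move=> hx ncx; apply: contraNT ncx; rewrite negb_or !negbK => /andP[/eqP e1 /eqP e2].
    by apply/eqP; apply: (fibres_inj (frame_delete fr v) fib) => //; apply: inX;
      rewrite ?eqxx ?orbT ?hx.
  have [|||||k [k' [h1 h2 h3]]] := @box_cut (f a) (f b) (f c) (f (s a)) (f (s b)) (f (s c)) e => //.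
  - by apply: apart; rewrite ?eqxx.
  - by apply: apart; rewrite ?eqxx ?orbT.
  exact: (fork_cut fk nca ncb gd h1 h2 h3).
(* If selecting [ab] does not keep [c] off the fibre of [a], then selecting its conjugate does, and
   [v] is exchanged with [s v]. *)
wlog nc : v a b c fk vW aW bW cW nca ncb t2ab /
    ~~ connect (add_edge (induced (delete W v) D) a b) a c.
  move=> wl; have := fork_not_collinear fk t2ab nca ncb; rewrite negb_and.
  case/orP => nc; first exact: (wl v a b c).
  apply: (wl _ _ _ _ (fork_conj fk)); rewrite ?sW ?(inj_eq s_inj) ?(sg_inv g2) //.
  by rewrite delete_conj.
have [g gd sep] := fork_double fk t2ab.
have cX : c \in delete W v.
  by apply: nbr_in_delete; rewrite // (fk_2 fk) // eqxx orbT.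
have [k [k' [h1 h2 h3]]] := separating_cut (g (s a)) (g (s b)) (g (s c)) e (sep c cX nc).
exact: (fork_cut fk nca ncb gd h1 h2 h3).
Qed.

End Step.

Theorem frame_realisable W t1 t2 D e : frame W t1 t2 D -> exists f, good W t1 t2 D e f.
Proof.
have [n] := ubnP #|W|; elim: n W t1 t2 D e => // n IHn W t1 t2 D e; rewrite ltnS => cW fr.
have IH e' W' t1' t2' D' : #|W'| < #|W| -> frame W' t1' t2' D' ->
    exists f, good W' t1' t2' D' e' f.
  by move=> c' fr'; apply: IHn fr'; apply: leq_trans cW.
have [/exists_inP[x xW sx]|] := boolP [exists x in W, s x != x]; last first.
  rewrite negb_exists_in => /forall_inP allfix.
  (* All vertices are fixed, so there is at most one. *)
  have eqW : {in W &, forall u w, u = w}.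
    move=> u w uW wW; have := allfix u uW; have := allfix w wW.
    by rewrite !negbK => /eqP ? /eqP ?; apply: (fr_fix fr).
  exists (fun _ => 0); split=> u w uW wW.
    by rewrite (eqW u w) // eqxx connect0.
  by rewrite /edge_ok (eqW u w) // (sg_irr (fr_g1 fr)) (sg_irr (fr_g2 fr)).
have [v [vW nsv low]] := frame_low_degree fr xW sx.
wlog le2 : t1 t2 D e fr low / degree W t2 v <= degree W t1 v.
  move=> wl; case: (leqP (degree W t2 v) (degree W t1 v)) => [|/ltnW] le.
    exact: (wl t1 t2 D e).
  have [|f gd] := wl t2 t1 D (~~ e) (frame_swap fr) _ le; first by rewrite addnC.
  by exists f; have := good_swap gd; rewrite negbK.
have degE t m : degree W t v = m -> exists2 r : seq V, size r = m &
    {subset r <= W} /\ uniq r /\ {in W, forall u, t v u = (u \in r)}.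
  move=> <-; exists (enum [set y in W | t v y]); first by rewrite /degree -cardE.
  split; first by move=> y; rewrite mem_enum inE => /andP[].
  by split; [exact: enum_uniq | move=> u uW; rewrite mem_enum inE uW].
(* The degree in [t2] is 0, or it is 1 and the degree in [t1] is 1 or 2. *)
case d2: (degree W t2 v) low le2 => [|[|d]].
- move=> _ _; have [r sz [_ [_ h]]] := degE _ _ d2.
  case: r sz h => // _ h.
  by apply: (step_no_t2 fr (IH e) vW nsv) => u uW; rewrite h.
- have [r sz [sub2 [_ h2]]] := degE _ _ d2.
  case: r sz sub2 h2 => [|c [|//]] // _ sub2 h2.
  have cW' : c \in W by apply: sub2; rewrite inE.
  have {}h2 : {in W, forall u, t2 v u = (u == c)} by move=> u uW; rewrite h2 // inE.
  case d1: (degree W t1 v) => [|[|[|d]]] low le //; try lia.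
    have [r sz [sub1 [_ h1]]] := degE _ _ d1.
    case: r sz sub1 h1 => [|a [|//]] // _ sub1 h1.
    apply: (step_pair fr (IH e) vW nsv _ cW' _ h2); first by apply: sub1; rewrite inE.
    by move=> u uW; rewrite h1 // inE.
  have [r sz [sub1 [uq h1]]] := degE _ _ d1.
  case: r sz sub1 uq h1 => [|a [|b [|//]]] // _ sub1 uq h1.
  apply: (step_fork fr (IH e) (v := v) (a := a) (b := b) (c := c)); split=> //.
  - by apply: sub1; rewrite !inE eqxx.
  - by apply: sub1; rewrite !inE eqxx orbT.
  - by move: uq; rewrite /= inE andbT.
  - by move=> u uW; rewrite h1 // !inE.
- by lia.
Qed.

End SymmetricForests.

(** * Edge sets of multigraphs *)

Section EdgeSets.
Variables (V E : finType) (src tgt : E -> V).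
Hypothesis loopless : loopfree src tgt.
Implicit Types (F : {set E}) (W : {set V}) (u w : V).

Local Notation joins := (joins src tgt).
Local Notation adj_in := (adj_in src tgt).

Lemma joinsC e u w : joins e u w = joins e w u.
Proof. by rewrite /joins orbC. Qed.

Lemma joins_pair e u w x y : joins e u w -> joins e x y -> pair_rel u w x y.
Proof.
rewrite /joins /pair_rel => /orP[] /andP[/eqP-> /eqP->] /orP[] /andP[/eqP-> /eqP->];
  by rewrite !eqxx ?orbT.
Qed.

Lemma joins_neq e u w : joins e u w -> u != w.
Proof.
by move=> /orP[] /andP[/eqP<- /eqP<-]; rewrite 1?eq_sym; have := loopless e; rewrite 1?eq_sym.
Qed.

Lemma adj_in_sym F : symmetric (adj_in F).
Proof.
by move=> u w; apply: eq_existsb => e; rewrite joinsC.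
Qed.

Lemma adj_in_irr F : irreflexive (adj_in F).
Proof. by move=> u; apply/exists_inP => -[e _ /joins_neq]; rewrite eqxx. Qed.

(** Two parallel edges would form a cycle of length 2. *)
Lemma acyclic_no_parallel F e e' u w : acyclic_in src tgt F ->
  e \in F -> e' \in F -> joins e u w -> joins e' u w -> e = e'.
Proof.
move=> acF eF e'F j j'; apply/eqP/negPn/negP => ne.
move/negP: (acF [:: e; e'] [:: u; w]); apply; rewrite /is_cycle_in /=.
by rewrite !inE ne (joins_neq j) eF e'F /= j joinsC j'.
Qed.

Lemma path_rcons_zip (e : rel V) (x : V) c z :
  path e x (rcons c z) = all (fun p => e p.1 p.2) (zip (x :: c) (rcons c z)).
Proof. by elim: c x => [|y c IHc] x //=; rewrite IHc. Qed.

(** With at least three distinct vertices, a closed walk never runs back along one of its steps;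
    hence edges picked for different steps are different. *)
Lemma zip_rcons_flip (x : V) c a b : uniq (x :: c) -> 1 < size c ->
  (a, b) \in zip (x :: c) (rcons c x) -> (b, a) \in zip (x :: c) (rcons c x) -> False.
Proof.
move=> uq sc /(nthP (x, x)) [i]; rewrite size_zip size_rcons /= minnn => li.
rewrite nth_zip ?size_rcons // => -[Ea Eb] /(nthP (x, x)) [j].
rewrite size_zip size_rcons /= minnn => lj; rewrite nth_zip ?size_rcons // => -[Eb' Ea'].
(* Cyclic successors: the last index wraps around to 0. *)
have nthS m : m < (size c).+1 -> nth x (rcons c x) m =
    nth x (x :: c) (if m == size c then 0 else m.+1).
  move=> lm; rewrite nth_rcons; case: ltngtP => //=; lia.
rewrite nthS // in Eb; rewrite nthS // in Ea'.
move: Eb; rewrite -Eb' => /eqP; rewrite nth_uniq //=; last by case: eqP; lia.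
move: Ea'; rewrite -Ea => /eqP; rewrite nth_uniq //=; last by case: eqP; lia.
by case: (i =P size c); case: (j =P size c) => ? ? /eqP ? /eqP ?; lia.
Qed.

Lemma acyclic_no_ucycle F x c : acyclic_in src tgt F -> uniq (x :: c) ->
  1 < size c -> cycle (adj_in F) (x :: c) -> False.
Proof.
move=> acF uq sc; rewrite [cycle _ _]/= path_rcons_zip => /allP cyc.
have [e0 _] : exists2 e, e \in F & true.
  case: c uq sc cyc => [|y c] //= _ _ /(_ (x, y)); rewrite inE eqxx => /(_ isT).
  by move=> /exists_inP[e eF _]; exists e.
(* The default [e0] is never reached on consecutive vertices of the cycle. *)
pose g (p : V * V) := odflt e0 [pick e in F | joins e p.1 p.2].
have gP p : p \in zip (x :: c) (rcons c x) -> g p \in F /\ joins (g p) p.1 p.2.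
  move=> /cyc /exists_inP[e eF je]; rewrite /g; case: pickP => [e' /andP[]//|/(_ e)].
  by rewrite eF je.
have zipE (s : seq (V * V)) : zip (map g s) s = [seq (g p, p) | p <- s].
  by elim: s => //= p s ->.
suff: is_cycle_in src tgt F [seq g p | p <- zip (x :: c) (rcons c x)] (x :: c).
  by rewrite (negbTE (acF _ _)).
have sz : size (zip (x :: c) (rcons c x)) = (size c).+1.
  by rewrite size_zip size_rcons /= minnn.
rewrite /is_cycle_in rot1_cons zipE size_map sz; apply/and5P; split=> //.
  rewrite map_inj_in_uniq ?zip_uniql //.
  move=> [a b] [a' b'] h h' Eg; have [_ j] := gP _ h; have [_ j'] := gP _ h'.
  rewrite /= Eg in j; case/pair_relP: (joins_pair j' j) => -[Ea Eb]; first by rewrite Ea Eb.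
  by subst a b; case: (zip_rcons_flip uq sc h h').
apply/andP; split; apply/allP.
  by move=> _ /mapP[p /gP[pF _] ->].
by move=> _ /mapP[p /gP[_ pj] ->].
Qed.

(** If all vertices of [X] had two neighbours in [X], a simple path could be prolonged at its first
    vertex beyond any length, since closing up would give a cycle. *)
Lemma acyclic_forest F W : acyclic_in src tgt F -> forest (adj_in F) W.
Proof.
move=> acF X _ X0.
have [/exists_inP[x xX dx]|] := boolP [exists x in X, #|[set y in X | adj_in F x y]| <= 1].
  by exists x.
rewrite negb_exists_in => /forall_inP two; exfalso.
suff long n : exists x p, [/\ size p = n, path (adj_in F) x p, uniq (x :: p)
    & {subset x :: p <= X}].
  have [x [p [sp _ uq _]]] := long #|V|.
  by have := max_card [in x :: p]; rewrite (card_uniqP uq) /= sp ltnn.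
elim: n => [|n [x [p [sp pp uq sX]]]].
  have [x xX] := set0Pn _ X0; exists x, [::]; split=> // y.
  by rewrite inE => /eqP->.
have xX : x \in X by apply: sX; rewrite inE eqxx.
(* A neighbour of the first vertex other than its successor; for a one-vertex path [head x p] is
   [x]. *)
have [y [yX axy ny]] : exists y, [/\ y \in X, adj_in F x y & y != head x p].
  have := two x xX; rewrite -ltnNge => /card_gt1P[y [z []]]; rewrite !inE.
  move=> /andP[yX axy] /andP[zX axz] nyz.
  have [Ey|ny] := eqVneq y (head x p); last by exists y.
  by exists z; split=> //; rewrite -Ey eq_sym.
have [yp|nyp] := boolP (y \in x :: p); last first.
  exists y, (x :: p); split=> /=; first by rewrite sp.
  - by rewrite adj_in_sym axy.
  - by rewrite nyp.
  by move=> z; rewrite inE => /orP[/eqP->|/sX].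
exfalso; case: p sp pp uq sX ny yp => [|h q] _ pp uq sX ny.
  by rewrite inE; apply/negP; apply: contraTneq axy => ->; rewrite adj_in_irr.
rewrite !inE (negbTE ny) /= => /orP[/eqP Eyx|yq].
  by rewrite Eyx adj_in_irr in axy.
case/splitPr: q / yq pp uq {sX ny} => q1 q2 pp uq.
(* As [y] lies beyond the second vertex [h], the cycle has at least three vertices. *)
apply: (@acyclic_no_ucycle F x (h :: rcons q1 y) acF).
- move: uq; rewrite -cat_rcons -!cat_cons cat_uniq => /and3P[] //.
- by rewrite /= size_rcons.
move: pp; rewrite -cat_rcons -cat_cons cat_path => /andP[pp _].
rewrite -[cycle _ _]/(path (adj_in F) x (rcons (h :: rcons q1 y) x)) rcons_path.
apply/andP; split; first exact: pp.
by rewrite /= last_rcons adj_in_sym.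
Qed.

End EdgeSets.

(** * Diagonal coordinates and framework colours *)

Section CoordinatePlane.
Implicit Types (A B : R) (V : finType).

(** The squares of the two sides differ by [4 * A * B]. *)
Lemma Rabs_sub_add A B : (Rabs (A - B) <= Rabs (A + B) <-> 0 <= A * B)%R.
Proof.
split=> h.
  apply: Rnot_lt_le => lt; apply: (Rlt_irrefl (Rabs (A - B))).
  apply: Rle_lt_trans h _; apply: Rsqr_lt_abs_0; rewrite /Rsqr; lra.
by apply: Rsqr_le_abs_0; rewrite /Rsqr; lra.
Qed.

Lemma Rabs_add_sub A B : (Rabs (A + B) <= Rabs (A - B) <-> A * B <= 0)%R.
Proof.
have := Rabs_sub_add A (- B).
rewrite (_ : A - - B = A + B)%R; last by lra.
by move=> [h1 h2]; split=> h; [have := h1 h | apply: h2]; lra.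
Qed.

Lemma RlebP x y : reflect (x <= y)%R (Rleb x y).
Proof. by rewrite /Rleb; case: Rle_dec => h; constructor. Qed.

Lemma ord2P (i : 'I_2) : i = ord0 \/ i = ord_max.
Proof. by case: i => -[|[|//]] h; [left | right]; apply: val_inj. Qed.

(** Up to scale, [f v] and [f (s v)] are the diagonal coordinates; exchanging them negates the
    second coordinate. *)
Definition plane_point V (s : V -> V) (f : V -> nat) (v : V) : point 2 :=
  [ffun i => if i == ord0 then (INR (f v) + INR (f (s v)))%R
             else (INR (f v) - INR (f (s v)))%R].

Lemma plane_point_conj V (s : V -> V) f v : involutive s ->
  plane_point s f (s v) = coord_reflection ord_max (plane_point s f v).
Proof.
move=> sK; apply/ffunP => i; rewrite !ffunE sK.
by case: (ord2P i) => -> /=; lra.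
Qed.

Lemma plane_point_inj V (s : V -> V) f u w :
  plane_point s f u = plane_point s f w -> f u = f w /\ f (s u) = f (s w).
Proof.
move=> /ffunP h; have := h ord0; have := h ord_max; rewrite !ffunE /= => h1 h0.
by split; apply: INR_eq; lra.
Qed.

(** With [A] and [B] the two factors of [d], the coordinate differences are [A + B] and [A - B], so
    the sign of [d] decides which is larger in absolute value. *)
Lemma fcols_plane_point V (s : V -> V) f u w :
  let d := (((INR (f u) - INR (f w)) * (INR (f (s u)) - INR (f (s w)))))%R in
  (ord0 \in fcols (plane_point s f u) (plane_point s f w) <-> (0 <= d)%R) /\
  (ord_max \in fcols (plane_point s f u) (plane_point s f w) <-> (d <= 0)%R).
Proof.
set A := (INR (f u) - INR (f w))%R; set B := (INR (f (s u)) - INR (f (s w)))%R => d.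
have d0 : (plane_point s f u ord0 - plane_point s f w ord0 = A + B)%R.
  by rewrite !ffunE /= /A /B; lra.
have d1 : (plane_point s f u ord_max - plane_point s f w ord_max = A - B)%R.
  by rewrite !ffunE /= /A /B; lra.
rewrite -Rabs_sub_add -Rabs_add_sub !inE; split; split.
- by move=> /forallP /(_ ord_max) /RlebP; rewrite d0 d1.
- move=> h; apply/forallP => j; apply/RlebP.
  by case: (ord2P j) => ->; rewrite ?d0 ?d1 //; apply: Rle_refl.
- by move=> /forallP /(_ ord0) /RlebP; rewrite d0 d1.
move=> h; apply/forallP => j; apply/RlebP.
by case: (ord2P j) => ->; rewrite ?d0 ?d1 //; apply: Rle_refl.
Qed.

Lemma INR_diff_sign (m n : nat) :
  [/\ m < n -> (INR m - INR n < 0)%R, n < m -> (0 < INR m - INR n)%R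
    & m = n -> (INR m - INR n = 0)%R].
Proof.
split=> [/ltP/lt_INR|/ltP/lt_INR|->]; lra.
Qed.

Lemma INR_diff_mul (a b c d : nat) : a != b -> c != d ->
  if (a < b) (+) (c < d) then ((INR a - INR b) * (INR c - INR d) < 0)%R
  else (0 < (INR a - INR b) * (INR c - INR d))%R.
Proof.
have [ab1 ab2 _] := INR_diff_sign a b; have [cd1 cd2 _] := INR_diff_sign c d.
case: ltngtP => // [/ab1|/ab2] h _; case: ltngtP => // [/cd1|/cd2] h' _ /=; nra.
Qed.

End CoordinatePlane.

(** * Symmetric decompositions *)

Section SymmetricDecomposition.
Variables (V E : finType) (src tgt : E -> V) (T : 'I_2 -> {set E}).
Variables (sV : V -> V) (sE : E -> E).
Hypothesis symT : sym_2tree_decomposition src tgt T sV sE.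
Hypothesis nofix : no_fixed_edges sE.
Implicit Types (i : 'I_2) (u w : V).

Local Notation joins := (joins src tgt).

Definition tree_adj i : rel V := adj_in src tgt (T i).

Let loopless : loopfree src tgt. Proof. by case: symT => -[]. Qed.
Let connT i : connected_in src tgt (T i).
Proof. by case: symT => -[_ [tree _]] _; case: (tree i). Qed.
Let acT i : acyclic_in src tgt (T i).
Proof. by case: symT => -[_ [tree _]] _; case: (tree i). Qed.
Let sVK : involutive sV. Proof. by case: symT => _ [[_ []]]. Qed.

Lemma joins_conj e u w : joins e u w -> joins (sE e) (sV u) (sV w).
Proof.
case: symT => _ [[[_ [_ aut]] _] _]; have := aut e.
by move=> j /orP[] /andP[/eqP<- /eqP<-] //; rewrite joinsC.
Qed.

Lemma tree_conj i e : e \in T i -> sE e \in T i.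
Proof. by case: symT => _ [_ sT] eT; rewrite -(sT i); apply: imset_f. Qed.

(** Otherwise an edge and its image would be parallel in one tree, hence equal, against [nofix]. *)
Lemma tree_adj_not_fixed i u w : tree_adj i u w -> ~~ pair_rel u w (sV u) (sV w).
Proof.
move=> /exists_inP[e eT je]; apply/negP => p; have je' := joins_conj je.
suff j : joins (sE e) u w.
  have := acyclic_no_parallel loopless (@acT i) (tree_conj eT) eT j je.
  by move/eqP; rewrite (negbTE (nofix e)).
by case/pair_relP: p je' => -[-> ->] //; rewrite joinsC.
Qed.

Lemma tree_adj_graph i : sym_graph sV (tree_adj i).
Proof.
have conj u w : tree_adj i u w -> tree_adj i (sV u) (sV w).
  move=> /exists_inP[e eT je]; apply/exists_inP; exists (sE e).
    exact: tree_conj.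
  exact: joins_conj.
split.
- exact: adj_in_sym.
- exact: adj_in_irr.
- by move=> u w; apply/idP/idP => [/conj|/conj//]; rewrite !sVK.
move=> u; apply/negP => /tree_adj_not_fixed/negP; apply; apply/pair_relP.
by right; rewrite sVK.
Qed.

(** The tree path between two fixed vertices and its image share neither first nor last edge, as
    such an edge would have both ends fixed. *)
Lemma fixed_vertex_unique u w : sV u = u -> sV w = w -> u = w.
Proof.
move=> su sw; apply/eqP/negPn/negP => nuw.
have gt := tree_adj_graph ord0.
have /connectP[p0 p0P w_def] := @connT ord0 u w.
case/shortenP: p0P w_def => p pP uq _ w_def {p0}.
case/lastP: p pP uq w_def => [|q w'] pP uq; first by move=> /= E0; rewrite E0 eqxx in nuw.
rewrite last_rcons => E0; subst w'.
have sq : rcons (map sV q) w = map sV (rcons q w) by rewrite map_rcons sw.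
have suq : u :: rcons (map sV q) w = map sV (u :: rcons q w) by rewrite sq /= su.
have no_fixed_edge x y : tree_adj ord0 x y -> sV x = x -> sV y = y -> False.
  move=> /tree_adj_not_fixed/negP h sx sy; apply: h.
  by apply/pair_relP; left.
apply: (forest_two_paths (W := setT) (q1 := q) (q2 := map sV q) (sg_sym gt)
  (acyclic_forest loopless (@acT ord0)) _ _ pP _ uq) => //.
- by move=> x _; rewrite inE.
- by move=> x _; rewrite inE.
- rewrite sq -{1}su path_map; apply: sub_path pP => x y; by rewrite /= (sg_inv gt).
- by rewrite suq map_inj_uniq //; apply: inv_inj.
- apply/eqP => h; case: q {uq sq suq} pP h => [|y q] /=.
    by move=> /andP[tuw _] _; apply: (no_fixed_edge u w).
  by move=> /andP[tuy _] h; apply: (no_fixed_edge u y).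
rewrite -{2}su last_map; apply/eqP => h.
move: pP; rewrite rcons_path => /andP[_ tlw].
exact: (no_fixed_edge (last u q) w).
Qed.

(** One representative of each double edge and its image; ranking vertex sets makes the choice
    independent of orientation. *)
Definition double_choice : rel V := fun u w =>
  [&& tree_adj ord0 u w, tree_adj ord_max u w &
      enum_rank [set u; w] < enum_rank [set sV u; sV w]].

Lemma decomposition_frame :
  frame sV setT (tree_adj ord0) (tree_adj ord_max) double_choice.
Proof.
split.
- by move=> u; rewrite !inE.
- by move=> u w _ _; apply: fixed_vertex_unique.
- exact: tree_adj_graph.
- exact: tree_adj_graph.
- exact: acyclic_forest.
- exact: acyclic_forest.
have [g0 g1] := (tree_adj_graph ord0, tree_adj_graph ord_max).
split.
- move=> u w; rewrite /double_choice (sg_sym g0) (sg_sym g1).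
  by rewrite [[set u; w]]setUC [[set sV u; sV w]]setUC.
- by move=> u w /and3P[]; rewrite !inE.
move=> u w _ _ h0 h1; rewrite /double_choice !(sg_inv g0, sg_inv g1) h0 h1 !sVK /=.
have : enum_rank [set u; w] != enum_rank [set sV u; sV w].
  rewrite (inj_eq enum_rank_inj); apply: contra (tree_adj_not_fixed h0) => /eqP E0.
  have nuw : u != w by apply: contraTneq h0 => ->; rewrite (sg_irr g0).
  have : sV u \in [set u; w] by rewrite E0 !inE eqxx.
  have : sV w \in [set u; w] by rewrite E0 !inE eqxx orbT.
  rewrite !inE => /orP[] /eqP sw /orP[] /eqP su; apply/pair_relP.
  - by case/eqP: nuw; apply: (inv_inj sVK); rewrite su sw.
  - by right.
  - by left.
  - by case/eqP: nuw; apply: (inv_inj sVK); rewrite su sw.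
by rewrite -val_eqE /=; case: ltngtP.
Qed.

(** For a double edge one factor of [d] vanishes and both colours occur; for a simple edge [edge_ok]
    gives the strict sign of [d]. *)
Lemma tree_adj_fcols f u w : good sV setT (tree_adj ord0) (tree_adj ord_max)
    double_choice false f ->
  tree_adj ord0 u w || tree_adj ord_max u w -> forall i,
  (i \in fcols (plane_point sV f u) (plane_point sV f w)) = tree_adj i u w.
Proof.
move=> [fib ed] adj; have [c0 c1] := fcols_plane_point sV f u w.
have fr := decomposition_frame.
set d := ((_ * _)%R) in c0 c1.
suff [e0 e1] : ((0 <= d)%R <-> tree_adj ord0 u w) /\ ((d <= 0)%R <-> tree_adj ord_max u w).
  move=> i; apply/idP/idP; case: (ord2P i) => ->.
  - by move/c0/e0.
  - by move/c1/e1.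
  - by move/e0/c0.
  - by move/e1/c1.
case h0: (tree_adj ord0 u w); case h1: (tree_adj ord_max u w).
- have d0 : d = 0%R.
    have := sel_xor (fr_sel fr) (in_setT u) (in_setT w) h0 h1.
    case: (boolP (double_choice u w)) => [D _|_ /= D].
      have /eqP E0 : f u == f w by rewrite fib ?inE // connect1.
      by rewrite /d E0; ring.
    have /eqP E0 : f (sV u) == f (sV w) by rewrite fib ?inE // connect1.
    by rewrite /d E0; ring.
  by rewrite d0; split; split=> // _; apply: Rle_refl.
- have x : tree_adj ord0 u w (+) tree_adj ord_max u w by rewrite h0 h1.
  have [n1 n2] := frame_xor_neq fr fib (in_setT u) (in_setT w) x.
  have := INR_diff_mul n1 n2; rewrite (ed _ _ (in_setT u) (in_setT w) x) h1 /= -/d => pos.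
  by split; split=> // h; lra.
- have x : tree_adj ord0 u w (+) tree_adj ord_max u w by rewrite h0 h1.
  have [n1 n2] := frame_xor_neq fr fib (in_setT u) (in_setT w) x.
  have := INR_diff_mul n1 n2; rewrite (ed _ _ (in_setT u) (in_setT w) x) h1 /= -/d => neg.
  by split; split=> // h; lra.
by rewrite h0 h1 in adj.
Qed.

Lemma symmetric_realisation : exists p, Cs_realisation src tgt T sV p.
Proof.
have fr := decomposition_frame.
have [f gd] := frame_realisable sVK false fr; have [fib _] := gd.
have [_ [_ [cover disj]]] : tree_decomposition src tgt T by case: symT.
pose kappa e : 'I_2 := if e \in T ord0 then ord0 else ord_max.
have kappaE e i : (kappa e == i) = (e \in T i).
  have e1 : (e \in T ord_max) = (e \notin T ord0).
    apply/idP/idP => [h|]; first by apply/negP => h'; have := disj _ _ _ h h'.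
    by have [j] := cover e; case: (ord2P j) => -> // ->.
  by rewrite /kappa; case: (ord2P i) => ->; rewrite ?e1; case: (e \in T ord0).
have adjE i u w : tree_adj i u w = (i \in kappa @: edges_between src tgt u w).
  apply/exists_inP/imsetP => [[e eT je]|[e]].
    by exists e; rewrite ?inE //; apply/eqP; rewrite eq_sym kappaE.
  by rewrite inE => je ->; exists e; rewrite // -kappaE.
have col : framework_colouring src tgt (plane_point sV f) kappa.
  move=> u w _ /card_gt0P[e0]; rewrite inE => je0; split.
    move=> e e'; rewrite !inE => je je' Ek.
    apply: (acyclic_no_parallel loopless (@acT (kappa e)) _ _ je je').
      by rewrite -kappaE.
    by rewrite -kappaE Ek.
  apply/setP => i; rewrite -adjE tree_adj_fcols //.
  have [j ej] := cover e0.
  have : tree_adj j u w by apply/exists_inP; exists e0.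
  by case: (ord2P j) => -> ->; rewrite ?orbT.
exists (plane_point sV f), ord_max; split; first by move=> v; apply: plane_point_conj.
split; first by move=> u w /plane_point_inj[]; apply: (fibres_inj sVK fr fib).
split; last by exists kappa.
(* Parallel edges have distinct colours, so counting colours counts edges. *)
by move=> u w nuw adj; have [inj <-] := col u w nuw adj; rewrite card_in_imset.
Qed.

End SymmetricDecomposition.

Theorem theorem5p10 (V E : finType) (src tgt : E -> V)
  (T : 'I_2 -> {set E}) (sV : V -> V) (sE : E -> E) :
  sym_2tree_decomposition src tgt T sV sE ->
  no_fixed_edges sE ->
  ~ (#|V| = 1 /\ #|E| = 0) ->
  exists p : V -> point 2, Cs_realisation src tgt T sV p.
Proof. by move=> symT nofix _; apply: symmetric_realisation symT nofix. Qed.
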